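(* Let $(N^{2n},J,h,\widetilde h)$ be a $2n$-dimensional holomorphic complex Riemannian manifold. Then the product manifold $M^{2n+1}=\mathbb R^+\times N^{2n}$, with $t$ the coordinate on $\mathbb R^+$, $\xi=\partial/\partial t$, and $$\eta=\mathrm{d}t,\quad \varphi|_{H}=J\ \ (H=\ker\eta),\quad \varphi\xi=0,\quad \eta\circ\varphi=0,\quad g=\mathrm{d}t^2+\cos 2t\; h-\sin 2t\;\widetilde h,$$ is a Sasaki-like almost contact complex Riemannian manifold. If $N^{2n}$ is compact, then $M^{2n+1}=S^1\times N^{2n}$, where $S^1=\mathbb R/2\pi\mathbb Z$ with angular coordinate $t$, endowed with the structure given by the same formulas, is a compact Sasaki-like almost contact complex Riemannian manifold.
   Context: A holomorphic complex Riemannian manifold $(N^{2n},J,h,\widetilde h)$ is a $2n$-dimensional manifold with an almost complex structure $J$ and a pseudo-Riemannian metric $h$ of signature $(n,n)$ such that $h(JX,JY)=-h(X,Y)$ and $J$ is parallel with respect to the Levi-Civita connection of $h$; the associated metric is $\widetilde h(X,Y)=h(JX,Y)$. An almost contact complex Riemannian manifold $(M,\varphi,\xi,\eta,g)$ is a smooth $(2n+1)$-dimensional manifold $M$ with an endomorphism field $\varphi$ of $TM$, a vector field $\xi$, a 1-form $\eta$ and a pseudo-Riemannian metric $g$ of signature $(n+1,n)$ such that $\varphi\xi=0$, $\varphi^2=-\mathrm{Id}+\eta\otimes\xi$, $\eta\circ\varphi=0$, $\eta(\xi)=1$ and $g(\varphi x,\varphi y)=-g(x,y)+\eta(x)\eta(y)$.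 Let $\nabla$ be the Levi-Civita connection of $g$ and $F(x,y,z)=g((\nabla_x\varphi)y,z)$. The manifold is Sasaki-like if for all $X,Y,Z$ in $H=\ker\eta$ one has $F(X,Y,Z)=F(\xi,Y,Z)=F(\xi,\xi,Z)=0$ and $F(X,Y,\xi)=-g(X,Y)$. *)

(* Defs.v *)
From HB Require Import structures.
From mathcomp Require Import all_boot all_order all_algebra generic_quotient.
From mathcomp Require Import all_classical all_reals all_analysis.

Set Implicit Arguments.
Unset Strict Implicit.
Unset Printing Implicit Defensive.

Import Order.TTheory GRing.Theory Num.Theory numFieldNormedType.Exports.

Local Open Scope classical_set_scope.
Local Open Scope ring_scope.

(* Conventions.  A manifold is given by an atlas, and a tensor field by its
   matrix of components in every chart of the atlas, subject to the usual law of
   change of components.  As in the library, linear maps act on row vectors on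
   the right: with respect to a chart, a tangent vector is a row [X], a 1-form a
   column [eta], with [eta(X) = X *m eta], an endomorphism a matrix [A], with
   [A(X) = X *m A], and a bilinear form a matrix [B], with
   [B(X, Y) = X *m B *m Y^T]. *)

Section Smooth.
Variables (R : realType) (V W : normedModType R).

(* Meant for open [U]. *)
Fixpoint Ck (k : nat) (U : set V) (f : V -> W) : Prop :=
  if k is k'.+1 then
    (forall x, U x -> differentiable f x) /\ (forall v, Ck k' U (derive f ^~ v))
  else {in U, continuous f}.

Definition smooth (U : set V) (f : V -> W) : Prop := forall k, Ck k U f.

End Smooth.

(* The raw data of an atlas; the axioms are in [is_manifold].  The values of
   [chart_map i] outside [dom i], and of [chart_inv i], the inverse of [chart_map i], outside
   [chart_map i @` dom i], are irrelevant. *)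
Record charted_space (R : realType) (m : nat) := ChartedSpace {
  carrier :> topologicalType ;
  chart : Type ;
  dom : chart -> set carrier ;
  chart_map : chart -> carrier -> 'rV[R]_m ;
  chart_inv : chart -> 'rV[R]_m -> carrier }.

Section Manifold.
Variables (R : realType) (m : nat) (M : charted_space R m).

Definition is_chart (i : chart M) : Prop :=
  [/\ open (dom i), open (chart_map i @` dom i),
      {in dom i, cancel (chart_map i) (chart_inv i)},
      {in dom i, continuous (chart_map i)} &
      {in chart_map i @` dom i, continuous (chart_inv i)}].

Definition transition (i j : chart M) : 'rV[R]_m -> 'rV[R]_m :=
  chart_map j \o chart_inv i.

Definition is_manifold : Prop :=
  [/\ hausdorff_space M, @second_countable M,
      forall p : M, exists i : chart M, dom i p,
      forall i : chart M, is_chart i &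
      forall i j : chart M,
        smooth (chart_map i @` (dom i `&` dom j)) (transition i j)].

(* Components of a field with values in [V], in each chart and at each point;
   the values outside the domain of the chart are irrelevant. *)
Definition components (V : Type) := chart M -> M -> V.

Definition smooth_components (V : normedModType R) (f : components V) : Prop :=
  forall i, smooth (chart_map i @` dom i) (f i \o chart_inv i).

Definition jac (i j : chart M) (p : M) : 'M[R]_m :=
  jacobian (transition i j) (chart_map i p).

Definition pderiv (V : normedModType R) (f : components V) (i : chart M)
    (p : M) (a : 'I_m) : V :=
  derive (f i \o chart_inv i) (chart_map i p) (delta_mx 0 a).

Definition is_vector_field (X : components 'rV[R]_m) : Prop :=
  smooth_components X /\
  forall i j p, dom i p -> dom j p -> X j p = X i p *m jac i j p.

Definition is_one_form (eta : components 'cV[R]_m) : Prop :=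
  smooth_components eta /\
  forall i j p, dom i p -> dom j p -> eta i p = jac i j p *m eta j p.

Definition is_endomorphism (A : components 'M[R]_m) : Prop :=
  smooth_components A /\
  forall i j p, dom i p -> dom j p ->
    A i p *m jac i j p = jac i j p *m A j p.

Definition is_bilinear (B : components 'M[R]_m) : Prop :=
  smooth_components B /\
  forall i j p, dom i p -> dom j p ->
    B i p = jac i j p *m B j p *m (jac i j p)^T.

Definition has_signature (r s : nat) (B : 'M[R]_m) : Prop :=
  [/\ (r + s)%N = m, B^T = B &
      exists2 P : 'M[R]_m, P \in unitmx &
        P *m B *m P^T = diag_mx (\row_(a < m) if (a < r)%N then 1 else -1)].

Definition is_metric (r s : nat) (g : components 'M[R]_m) : Prop :=
  is_bilinear g /\ forall i p, dom i p -> has_signature r s (g i p).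

(* [row b (Gamma a i p)] is the vector nabla_(d_a) d_b in the chart [i], so that
   nabla_(d_a) X = d_a X + X *m Gamma a.  The change of components between two
   charts is the condition that nabla_X Y is a vector field when X and Y are. *)
Definition is_connection (Gamma : 'I_m -> components 'M[R]_m) : Prop :=
  (forall a, smooth_components (Gamma a)) /\
  forall i j p a, dom i p -> dom j p ->
    Gamma a i p *m jac i j p =
      pderiv (fun k => jac k j) i p a +
      \sum_l jac i j p a l *: (jac i j p *m Gamma l j p).

Definition torsion_free (Gamma : 'I_m -> components 'M[R]_m) : Prop :=
  forall i p a b, dom i p -> row b (Gamma a i p) = row a (Gamma b i p).

Definition metric_compatible (g : components 'M[R]_m)
    (Gamma : 'I_m -> components 'M[R]_m) : Prop :=
  forall i p a, dom i p ->
    pderiv g i p a = Gamma a i p *m g i p + g i p *m (Gamma a i p)^T.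

Definition is_levi_civita (g : components 'M[R]_m)
    (Gamma : 'I_m -> components 'M[R]_m) : Prop :=
  [/\ is_connection Gamma, torsion_free Gamma & metric_compatible g Gamma].

(* The endomorphism nabla_X A, where (nabla_X A) Y = nabla_X (A Y) - A (nabla_X Y). *)
Definition nabla_endo (Gamma : 'I_m -> components 'M[R]_m)
    (A : components 'M[R]_m) (i : chart M) (p : M) (X : 'rV[R]_m) : 'M[R]_m :=
  \sum_a X 0 a *:
    (pderiv A i p a + A i p *m Gamma a i p - Gamma a i p *m A i p).

Definition bil (B : components 'M[R]_m) (i : chart M) (p : M)
    (X Y : 'rV[R]_m) : R :=
  (X *m B i p *m Y^T) 0 0.

End Manifold.

Definition associated_metric (R : realType) (m : nat) (N : charted_space R m)
    (J h : components N 'M[R]_m) : components N 'M[R]_m :=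
  fun i p => J i p *m h i p.

Definition holomorphic_complex_riemannian (R : realType) (n : nat)
    (N : charted_space R (2 * n)) (J h : components N 'M[R]_(2 * n)) : Prop :=
  [/\ is_manifold N,
      is_endomorphism J /\
        (forall i p, dom i p -> J i p *m J i p = - 1%:M),
      is_metric n n h,
      forall i p (X Y : 'rV[R]_(2 * n)), dom i p ->
        bil h i p (X *m J i p) (Y *m J i p) = - bil h i p X Y &
      exists2 Gamma, is_levi_civita h Gamma &
        forall i p X, dom i p -> nabla_endo Gamma J i p X = 0].

Section AlmostContact.
Variables (R : realType) (n : nat) (M : charted_space R (2 * n).+1).
Variables (phi : components M 'M[R]_((2 * n).+1))
  (xi : components M 'rV[R]_((2 * n).+1)) (eta : components M 'cV[R]_((2 * n).+1))
  (g : components M 'M[R]_((2 * n).+1)).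

Definition almost_contact_complex_riemannian : Prop :=
  [/\ is_manifold M, is_endomorphism phi, is_vector_field xi, is_one_form eta &
      is_metric n.+1 n g] /\
  forall i p, dom i p ->
    [/\ xi i p *m phi i p = 0,
        phi i p *m phi i p = - 1%:M + eta i p *m xi i p,
        phi i p *m eta i p = 0,
        xi i p *m eta i p = 1%:M &
        forall X Y : 'rV[R]_((2 * n).+1),
          bil g i p (X *m phi i p) (Y *m phi i p) =
          - bil g i p X Y + (X *m eta i p) 0 0 * (Y *m eta i p) 0 0].

Definition fundamental_tensor
    (Gamma : 'I_(2 * n).+1 -> components M 'M[R]_((2 * n).+1))
    (i : chart M) (p : M) (x y z : 'rV[R]_((2 * n).+1)) : R :=
  bil g i p (y *m nabla_endo Gamma phi i p x) z.

Definition sasaki_like : Prop :=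
  almost_contact_complex_riemannian /\
  exists2 Gamma, is_levi_civita g Gamma &
    forall i p, dom i p ->
      let F := fundamental_tensor Gamma i p in
      forall X Y Z : 'rV[R]_((2 * n).+1),
        X *m eta i p = 0 -> Y *m eta i p = 0 -> Z *m eta i p = 0 ->
        [/\ F X Y Z = 0, F (xi i p) Y Z = 0, F (xi i p) (xi i p) Z = 0 &
            F X Y (xi i p) = - bil g i p X Y].

End AlmostContact.

Definition product_space (R : realType) (m1 m2 : nat)
    (M1 : charted_space R m1) (M2 : charted_space R m2) :
    charted_space R (m1 + m2) :=
  @ChartedSpace R (m1 + m2) (M1 * M2)%type (chart M1 * chart M2)%type
    (fun i => dom i.1 `*` dom i.2)
    (fun i p => row_mx (chart_map i.1 p.1) (chart_map i.2 p.2))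
    (fun i v => (chart_inv i.1 (lsubmx v), chart_inv i.2 (rsubmx v))).

Section OneDimensional.
Variable R : realType.

Definition posR : set R := [set t | 0 < t].

Lemma posR1 : (1 : R) \in posR.
Proof. by rewrite inE /posR /= ltr01. Qed.

Definition positive_line : charted_space R 1 :=
  @ChartedSpace R 1 (set_type posR) unit
    (fun=> setT)
    (fun _ t => const_mx (set_val t))
    (fun _ v => insubd (exist _ 1 posR1 : set_type posR) (v 0 0)).

Definition same_angle (s t : R) : bool :=
  `[< exists k : int, s - t = k%:~R * (2 * pi) >].

Lemma same_angle_is_equiv : equiv_class_of same_angle.
Proof.
split=> [t|s t|s t u].
- by apply/asboolP; exists 0; rewrite subrr mul0r.
- by apply/asboolP/asboolP => -[k e]; exists (- k);
    rewrite -opprB e mulrNz mulNr.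
- move=> /asboolP[k e] /asboolP[l f]; apply/asboolP; exists (k + l).
  by rewrite intrD mulrDl -e -f addrA subrK.
Qed.

Canonical same_angle_equiv := EquivRelPack same_angle_is_equiv.

Definition angle := {eq_quot same_angle_equiv}%qT.

Definition angle_of (t : R) : quotient_topology angle := (\pi_angle t)%qT.

(* In the chart of index [a], the coordinate of a point of the circle is its
   unique representative in ]a, a + 2 pi[. *)
Definition circle : charted_space R 1 :=
  @ChartedSpace R 1 (quotient_topology angle) R
    (fun a => angle_of @` [set t : R | a < t < a + 2 * pi])
    (fun a x =>
       const_mx (xget a [set t : R | a < t < a + 2 * pi /\ angle_of t = x]))
    (fun _ v => angle_of (v 0 0)).

End OneDimensional.

(* The structure on B x N, for a 1-dimensional B all of whose charts are
   determinations of the coordinate t. *)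
Section Cylinder.
Variables (R : realType) (n : nat).
Variables (B : charted_space R 1) (N : charted_space R (2 * n)).
Variables (J h : components N 'M[R]_(2 * n)).

Definition cylinder : charted_space R (2 * n).+1 := product_space B N.

Definition cyl_phi : components cylinder 'M[R]_((2 * n).+1) :=
  fun i p => block_mx (0 : 'M[R]_1) 0 0 (J i.2 p.2).

Definition cyl_xi : components cylinder 'rV[R]_((2 * n).+1) :=
  fun i p => row_mx (1%:M : 'M[R]_1) 0.

Definition cyl_eta : components cylinder 'cV[R]_((2 * n).+1) :=
  fun i p => col_mx (1%:M : 'M[R]_1) 0.

Definition cyl_metric : components cylinder 'M[R]_((2 * n).+1) :=
  fun i p => let t := chart_map i.1 p.1 0 0 in
    block_mx (1%:M : 'M[R]_1) 0 0
      (cos (2 * t) *: h i.2 p.2 - sin (2 * t) *: associated_metric J h i.2 p.2).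

End Cylinder.

Arguments cyl_phi {R n} B {N} J.
Arguments cyl_xi {R n} B N.
Arguments cyl_eta {R n} B N.
Arguments cyl_metric {R n} B {N} J h.

(* Main.v *)
(** The half-line and the circle both carry a coordinate t whose transition
    functions are translations preserving cos 2t and sin 2t.  Write h~ = h(J ., .) and
    h_t = cos 2t h - sin 2t h~ on N.  As J is self-adjoint for h and J^2 = -1,
    h_t is the pull-back of h by cos t - sin t J, hence has the signature of h,
    and d/dt h_t = - 2 h_t(J ., .).  As J is parallel, the Levi-Civita
    connection D of h is also that of every h_t, so that the Levi-Civita
    connection of g = dt^2 + h_t is
      nabla_X Y = D_X Y + h_t(J X, Y) d_t,
      nabla_t X = nabla_X d_t = - J X,  nabla_t d_t = 0.
    Hence (nabla_t phi) = 0, (nabla_X phi) d_t = - X and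
    (nabla_X phi) Y = - h_t(X, Y) d_t. *)
Require Import Defs.
From HB Require Import structures.
From mathcomp Require Import all_boot all_order all_algebra generic_quotient.
From mathcomp Require Import all_classical all_reals all_analysis.
From mathcomp Require Import ring lra zify.

Set Implicit Arguments.
Unset Strict Implicit.
Unset Printing Implicit Defensive.

Import Order.TTheory GRing.Theory Num.Theory numFieldNormedType.Exports.

Local Open Scope classical_set_scope.
Local Open Scope ring_scope.

(** The family h_t is best read on the complex-bilinear form H = h - i h~, for which H(J X, Y) = i
    H(X, Y): h_t is the real part of e^(-2it) H. The factor cos t - sin t J is multiplication by
    e^(-it), and a bilinear form sees it squared, which is the origin of the angle 2t;
    differentiating e^(-2it) then gives - 2 h_t(J ., .). The factor 2 is what makes nabla_X d_t
    equal to - J X, because d/dt h_t(X, Y) is the sum of the two equal terms h_t(nabla_X d_t, Y) and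
    h_t(X, nabla_Y d_t). That normalisation is in turn what yields F(X, Y, xi) = - g(X, Y) with
    coefficient one. The Levi-Civita connection is not derived from a Koszul formula: it is given by
    explicit matrices in the charts, and its transformation law, its symmetry and its compatibility
    with g are checked block by block. Fields are differentiated after composition with [chart_inv],
    where most identities hold only near a point; hence the repeated passage through local
    equality. *)

(** * Functions of class C^k *)

Lemma near_eq_differentiable (R : realType) (V W : normedModType R)
    (f g : V -> W) x :
  {near x, f =1 g} -> differentiable f x -> differentiable g x.
Proof.
move=> fg /diff_locallyP[cf ef].
have fgx : f x = g x by exact: (nbhs_singleton fg).
(* The first-order expansion of f at x is also one of g, so [diff_unique] identifies the two
   differentials. *)
have eg : g \o shift x = cst (g x) + 'd f x +o_ 0 id.
  apply/eqaddoP => e e0; move/eqaddoP : ef => /(_ _ e0) ef.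
  have fg0 : \forall y \near 0, f (y + x) = g (y + x).
    by move: fg; rewrite (near_shift 0); apply: filterS => y /=; rewrite subr0.
  near=> y; rewrite !fctE -fgx /=.
  have -> : g (y + x) = f (y + x) by apply/esym; near: y.
  by near: y.
apply/diff_locallyP; rewrite (diff_unique cf eg); split => //.
Unshelve. all: by end_near. Qed.

Section Ck_theory.
Variable R : realType.
Implicit Types V W : normedModType R.

Lemma sub_Ck V W k (U U' : set V) (f : V -> W) :
  U' `<=` U -> Ck k U f -> Ck k U' f.
Proof.
move=> sU; elim: k f => [|k IHk] f /=.
  by move=> cf x /set_mem /sU Ux; apply: cf; rewrite inE.
by case=> df ddf; split=> [x /sU /df //|v]; apply: IHk.
Qed.

Lemma CkW V W k (U : set V) (f : V -> W) : Ck k.+1 U f -> Ck k U f.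
Proof.
elim: k f => [|k IHk] f [df ddf].
  by move=> x /set_mem /df /differentiable_continuous.
by split=> // v; apply: IHk.
Qed.

Lemma smoothP V W (U : set V) (f : V -> W) :
  smooth U f <->
  (forall x, U x -> differentiable f x) /\ forall v, smooth U (derive f ^~ v).
Proof.
split=> [sf|[df sf] [|k]].
- by split=> [|v k]; [case: (sf 1%N)|case: (sf k.+1) => _; exact].
- by move=> x /set_mem /df /differentiable_continuous.
- by split=> // v; apply: sf.
Qed.

(** On an open set, equality on U is equality near each point of U, so it passes to all derivatives.
    This is what allows rules of differentiation valid only on U to be used in the inductions
    below. *)
Lemma eq_Ck V W k (U : set V) (f g : V -> W) :
  open U -> {in U, f =1 g} -> Ck k U f -> Ck k U g.
Proof.
move=> oU; have nearU (f' g' : V -> W) x :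
    {in U, f' =1 g'} -> U x -> {near x, f' =1 g'}.
  move=> fg Ux; have := open_nbhs_nbhs (conj oU Ux).
  by apply: filterS => y Uy; apply: fg; rewrite inE.
elim: k f g => [|k IHk] f g fg.
  move=> cf x Ux; have fgx := nearU _ _ _ fg (set_mem Ux).
  apply: cvg_trans (near_eq_cvg fgx) _; rewrite -(fg x Ux); exact: cf.
case=> df ddf; split=> [x Ux|v].
  exact: near_eq_differentiable (nearU _ _ _ fg Ux) (df x Ux).
apply: IHk (ddf v) => x /set_mem Ux; exact/near_eq_derive/nearU.
Qed.

Lemma Ck_cst V W k (U : set V) (c : W) : Ck k U (cst c).
Proof.
elim: k c => [|k IHk] c; first by move=> x _; exact: cst_continuous.
split=> [x _|v]; first exact: differentiable_cst.
rewrite (_ : derive _ ^~ v = cst 0) //.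
by apply/funext => x; rewrite derive_cst.
Qed.

Lemma CkD V W k (U : set V) (f g : V -> W) : open U ->
  Ck k U f -> Ck k U g -> Ck k U (f \+ g).
Proof.
move=> oU; elim: k f g => [|k IHk] f g.
  by move=> cf cg x Ux; apply: cvgD; [exact: cf|exact: cg].
case=> df ddf [dg ddg]; split=> [x Ux|v].
  by apply: differentiableD; [exact: df|exact: dg].
apply: eq_Ck (IHk _ _ (ddf v) (ddg v)) => // x /set_mem Ux /=.
by rewrite deriveD //; apply: diff_derivable; [exact: df|exact: dg].
Qed.

Lemma Ck_sum V W k (U : set V) (I : Type) (r : seq I) (F : I -> V -> W) :
  open U -> (forall i, Ck k U (F i)) -> Ck k U (fun x => \sum_(i <- r) F i x).
Proof.
move=> oU CF; elim: r => [|i r IHr].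
  by under eq_fun do rewrite big_nil; exact: Ck_cst.
by under eq_fun do rewrite big_cons; exact: CkD.
Qed.

Lemma CkM V k (U : set V) (f g : V -> R) : open U ->
  Ck k U f -> Ck k U g -> Ck k U (f \* g).
Proof.
move=> oU; elim: k f g => [|k IHk] f g.
  by move=> cf cg x Ux; apply: cvgM; [exact: cf|exact: cg].
move=> Cf Cg; have [df ddf] := Cf; have [dg ddg] := Cg; split=> [x Ux|v].
  by apply: differentiableM; [exact: df|exact: dg].
(* Each term of the product rule pairs a derivative, of class k only, with an undifferentiated
   factor, which is lowered to class k. *)
apply: eq_Ck (CkD oU (IHk _ _ (CkW Cf) (ddg v)) (IHk _ _ (CkW Cg) (ddf v))).
  by [].
move=> x /set_mem Ux /=.
by rewrite deriveM //; apply: diff_derivable; [exact: df|exact: dg].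
Qed.

Lemma Ck_linear_comp V W W' k (U : set V) (f : V -> W) (L : {linear W -> W'}) :
  open U -> continuous L -> Ck k U f -> Ck k U (L \o f).
Proof.
move=> oU cL; elim: k f => [|k IHk] f.
  by move=> cf x Ux; apply: continuous_comp; [exact: cf|exact: cL].
case=> df ddf.
have dL x : U x -> differentiable (L \o f) x.
  by move=> Ux; apply: differentiable_comp; [exact: df|exact: linear_differentiable].
split=> // v; apply: eq_Ck (IHk _ (ddf v)) => // x /set_mem Ux /=.
have dfx := df x Ux; have dLx := dL x Ux; rewrite !deriveE //.
by rewrite (@diff_comp _ _ _ _ f L) ?diff_lin //; exact: linear_differentiable.
Qed.

(** By linearity of L the two difference quotients are the same function, before any limit is
    taken. *)
Lemma derive_comp_linear V V' W (f : V -> W) (L : {linear V' -> V}) x v :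
  'D_v (f \o L) x = 'D_(L v) f (L x).
Proof.
rewrite /derive; set d := (fun _ : R => _); set d' := (fun _ : R => _).
by suff -> : d = d' by []; apply/funext => t; rewrite /d /d' /= linearP.
Qed.

(** A derivative of f \o L is again a function composed with L, so the induction keeps its shape.
    The inner maps in view are the two block projections and v |-> 2 v. *)
Lemma Ck_comp_linear V V' W k (U : set V) (f : V -> W) (L : {linear V' -> V}) :
  continuous L -> Ck k U f -> Ck k (L @^-1` U) (f \o L).
Proof.
move=> cL; elim: k f => [|k IHk] f.
  move=> cf x /set_mem Ux; apply: continuous_comp; first exact: cL.
  by apply: cf; rewrite inE.
case=> df ddf; split=> [x Ux|v].
  have dLx : differentiable L x by exact: linear_differentiable.
  by apply: (@differentiable_comp _ _ _ _ L f) => //; exact: df.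
rewrite (_ : derive _ ^~ v = derive f ^~ (L v) \o L).
  exact: IHk (ddf (L v)).
by apply/funext => x; rewrite derive_comp_linear.
Qed.

Lemma CkZr V W k (U : set V) (f : V -> R) (w : W) : open U ->
  Ck k U f -> Ck k U (fun x => f x *: w).
Proof.
move=> oU; elim: k f => [|k IHk] f.
  by move=> cf x Ux; apply: cvgZr_tmp; exact: cf.
case=> df ddf; split=> [x Ux|v].
  by apply: differentiableZl; exact: df.
apply: eq_Ck (IHk _ (ddf v)) => // x /set_mem Ux /=.
have dfx := df _ Ux; have dfw : differentiable (fun z => f z *: w) x.
  exact: differentiableZl.
by rewrite !deriveE // diffZl.
Qed.

(** Reduces every matrix operation on smooth fields to sums and products of scalar functions. *)
Lemma Ck_mxP V m n k (U : set V) (f : V -> 'M[R]_(m, n)) : open U ->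
  Ck k U f <-> forall i j, Ck k U (fun x => f x i j).
Proof.
move=> oU; split=> [Cf i j|Cf].
  have coord_linear : linear (fun A : 'M[R]_(m, n) => A i j : R).
    by move=> a A B; rewrite !mxE.
  pose coordL : {linear _ -> _} :=
    HB.pack (fun A : 'M[R]_(m, n) => A i j) (GRing.isLinear.Build _ _ _ _ _ coord_linear).
  by apply: (@Ck_linear_comp _ _ _ _ _ _ coordL) => //; exact: coord_continuous.
have -> : f = fun x => \sum_i \sum_j f x i j *: delta_mx i j.
  by apply/funext => x; exact: matrix_sum_delta.
by apply: Ck_sum => // i; apply: Ck_sum => // j; exact: CkZr.
Qed.

Lemma Ck_mulmx V m n p k (U : set V) (f : V -> 'M[R]_(m, n))
    (g : V -> 'M[R]_(n, p)) :
  open U -> Ck k U f -> Ck k U g -> Ck k U (fun x => f x *m g x).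
Proof.
move=> oU /(Ck_mxP _ _ oU) Cf /(Ck_mxP _ _ oU) Cg; apply/Ck_mxP => // i j.
under eq_fun do rewrite mxE.
by apply: Ck_sum => // l; exact: CkM.
Qed.

Lemma Ck_scalemx V m n k (U : set V) (c : V -> R) (f : V -> 'M[R]_(m, n)) :
  open U -> Ck k U c -> Ck k U f -> Ck k U (fun x => c x *: f x).
Proof.
move=> oU Cc /(Ck_mxP _ _ oU) Cf; apply/Ck_mxP => // i j.
by under eq_fun do rewrite mxE; exact: CkM.
Qed.

Lemma Ck_row_mx V m n1 n2 k (U : set V) (f : V -> 'M[R]_(m, n1))
    (g : V -> 'M[R]_(m, n2)) :
  open U -> Ck k U f -> Ck k U g -> Ck k U (fun x => row_mx (f x) (g x)).
Proof.
move=> oU /(Ck_mxP _ _ oU) Cf /(Ck_mxP _ _ oU) Cg; apply/Ck_mxP => // i j.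
case: (split_ordP j) => l ->.
  by under eq_fun do rewrite row_mxEl.
by under eq_fun do rewrite row_mxEr.
Qed.

Lemma Ck_col_mx V m1 m2 n k (U : set V) (f : V -> 'M[R]_(m1, n))
    (g : V -> 'M[R]_(m2, n)) :
  open U -> Ck k U f -> Ck k U g -> Ck k U (fun x => col_mx (f x) (g x)).
Proof.
move=> oU /(Ck_mxP _ _ oU) Cf /(Ck_mxP _ _ oU) Cg; apply/Ck_mxP => // i j.
case: (split_ordP i) => l ->.
  by under eq_fun do rewrite col_mxEu.
by under eq_fun do rewrite col_mxEd.
Qed.

Lemma Ck_block_mx V m1 m2 n1 n2 k (U : set V) (f : V -> 'M[R]_(m1, n1))
    (g : V -> 'M[R]_(m1, n2)) (h : V -> 'M[R]_(m2, n1)) (l : V -> 'M[R]_(m2, n2)) :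
  open U -> Ck k U f -> Ck k U g -> Ck k U h -> Ck k U l ->
  Ck k U (fun x => block_mx (f x) (g x) (h x) (l x)).
Proof.
by move=> oU Cf Cg Ch Cl; apply: Ck_col_mx => //; exact: Ck_row_mx.
Qed.

(** The induction is joint because each function is, up to sign, the derivative of the other. *)
Lemma Ck_cos_sin k : Ck k setT (@cos R) /\ Ck k setT (@sin R).
Proof.
elim: k => [|k [Ccos Csin]].
  by split=> x _; [exact: continuous_cos|exact: continuous_sin].
have oT := @openT R.
have dcos x : differentiable (@cos R) x.
  exact/derivable1_diffP/derivable_cos.
have dsin x : differentiable (@sin R) x.
  exact/derivable1_diffP/derivable_sin.
have D1 (f : R -> R) x v : differentiable f x -> 'D_v f x = 'D_1 f x * v.
  move=> df; rewrite !deriveE // -[in LHS](mulr1 v).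
  by rewrite -[v * 1]/(v *: (1 : R)) linearZ mulrC.
split; split=> // v.
  have -> : derive cos ^~ v = (fun x : R => sin x *: (- v)).
    apply/funext => x; rewrite D1 // derive_val.
    by rewrite /GRing.scale /= mulrN mulNr.
  exact: CkZr.
have -> : derive sin ^~ v = (fun x : R => cos x *: v).
  by apply/funext => x; rewrite D1 // derive_val.
exact: CkZr.
Qed.

End Ck_theory.

(** * Atlases and products *)

Lemma mx_continuous_at (T U : topologicalType) m n (f : T -> 'M[U]_(m, n)) x :
  (forall i j, {for x, continuous (fun y => f y i j)}) ->
  {for x, continuous f}.
Proof.
move=> cf A [P fxP sPA].
have : \forall y \near x, forall ij : 'I_m * 'I_n, P ij.1 ij.2 (f y ij.1 ij.2).
  by apply: filter_forall => -[i j] /=; apply: (cf i j); exact: fxP.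
by apply: filterS => y Py; apply: sPA => i j; exact: (Py (i, j)).
Qed.

Lemma const_mx_continuous (T : topologicalType) m n :
  continuous (@const_mx T m n).
Proof.
move=> x; apply: mx_continuous_at => i j.
suff -> : (fun y : T => const_mx y i j) = id by [].
by apply/funext => y; rewrite mxE.
Qed.

Lemma continuous_pair_at (S T U : topologicalType) (f : S -> T) (g : S -> U) x :
  {for x, continuous f} -> {for x, continuous g} ->
  {for x, continuous (fun y => (f y, g y))}.
Proof. by move=> cf cg; exact: (cvg_pair cf cg). Qed.

Lemma openX (S T : topologicalType) (A : set S) (B : set T) :
  open A -> open B -> open (A `*` B).
Proof.
rewrite !openE => oA oB [x y] [/= Ax By].
by exists (A, B) => //; split=> /=; [exact: oA|exact: oB].
Qed.

Lemma hausdorff_injective (S T : topologicalType) (f : S -> T) :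
  continuous f -> injective f -> hausdorff_space T -> hausdorff_space S.
Proof.
move=> cf injf hT p q clpq; apply: injf; apply: hT => A B nA nB.
by have [s [As Bs]] := clpq _ _ (cf _ _ nA) (cf _ _ nB); exists (f s).
Qed.

Lemma hausdorff_prod (S T : topologicalType) :
  hausdorff_space S -> hausdorff_space T -> hausdorff_space (S * T)%type.
Proof.
move=> hS hT [p1 p2] [q1 q2] clpq; congr (_, _).
  apply: hS => A B nA nB.
  have [[s t] [/= As Bs]] := clpq _ _ (cvg_fst (F := nbhs p1) (G := nbhs p2) nA)
    (cvg_fst (F := nbhs q1) (G := nbhs q2) nB).
  by exists s.
apply: hT => A B nA nB.
have [[s t] [/= As Bs]] := clpq _ _ (cvg_snd (F := nbhs p1) (G := nbhs p2) nA)
  (cvg_snd (F := nbhs q1) (G := nbhs q2) nB).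
by exists t.
Qed.

Lemma second_countable_prod (S T : topologicalType) :
  @second_countable S -> @second_countable T ->
  @second_countable (S * T)%type.
Proof.
move=> [B1 cB1 [oB1 bB1]] [B2 cB2 [oB2 bB2]].
exists [set C.1 `*` C.2 | C in B1 `*` B2].
  exact: sub_countable (card_image_le _ _) (countableX cB1 cB2).
split=> [_ [[C D] [/= BC BD] <-]|[x y] A [[A1 A2] [/= nA1 nA2] sA]].
  by apply: openX; [exact: oB1|exact: oB2].
have [C [BC Cx] sC] := bB1 _ _ nA1; have [D [BD Dy] sD] := bB2 _ _ nA2.
exists (C `*` D); first by split=> //; exists (C, D).
by move=> [s t] [/= Cs Dt]; apply: sA; split; [exact: sC|exact: sD].
Qed.

Lemma second_countable_initial (S : choiceType) (T : topologicalType)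
    (f : S -> T) :
  @second_countable T -> @second_countable (initial_topology f).
Proof.
move=> [B cB [oB bB]]; exists [set f @^-1` C | C in B].
  exact: sub_countable (card_image_le _ _) cB.
split=> [_ [C BC <-]|x A [_ [[D oD <-] /= Dfx] sDA]].
  by exists C => //; exact: oB.
have [C [BC Cfx] sCD] := bB _ _ (open_nbhs_nbhs (conj oD Dfx)).
exists (f @^-1` C); first by split=> //; exists C.
by move=> y Cfy; apply: sDA; exact: sCD.
Qed.

(** Meant for the quotient map from the line onto the circle, which is open. *)
Lemma second_countable_open_image (S T : topologicalType) (f : S -> T) :
  continuous f -> (forall U, open U -> open (f @` U)) -> f @` setT = setT ->
  @second_countable S -> @second_countable T.
Proof.
move=> cf openf surjf [B cB [oB bB]]; exists [set f @` C | C in B].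
  exact: sub_countable (card_image_le _ _) cB.
split=> [_ [C BC <-]|y A nA]; first by apply: openf; exact: oB.
have [x _ xy] : (f @` setT) y by rewrite surjf.
rewrite -xy in nA *; have [C [BC Cx] sCA] := bB _ _ (cf _ _ nA).
exists (f @` C); first by split; [exists C|exists x].
by move=> _ [s Cs <-]; exact: sCA.
Qed.

Lemma second_countable_real (R : realType) : @second_countable R.
Proof.
exists (range (fun q : rat * rat => [set x : R | ratr q.1 < x < ratr q.2])).
  exact: sub_countable (card_image_le _ _) (countableP _).
split=> [_ [q _ <-]|x A /nbhs_ballP[e /= e0 eA]].
  by rewrite (_ : [set _ | _] = [set` `]ratr q.1, ratr q.2[%R]);
    [exact: interval_open|apply/seteqP; split=> y; rewrite /= in_itv].
have /rat_in_itvoo[q /itvP qx] : x - e < x by rewrite ltrBlDr ltrDl.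
have /rat_in_itvoo[r /itvP rx] : x < x + e by rewrite ltrDl.
exists [set x : R | ratr q < x < ratr r].
  by split; [exists (q, r)|rewrite /= qx rx].
move=> y /andP[qy yr]; apply: eA; rewrite /ball /= ltr_norml.
have : x - e < y by rewrite (lt_trans _ qy) ?qx.
have : y < x + e by rewrite (lt_trans yr) ?rx.
by move=> *; apply/andP; split; lra.
Qed.

Section Charts.
Variables (R : realType) (m : nat) (M : charted_space R m).
Implicit Types i j : chart M.

(** Trades a direct image under [chart_map] for a preimage under [chart_inv], whose continuity then
    gives openness. *)
Lemma chart_map_image i (U : set M) :
  is_chart i -> chart_map i @` (dom i `&` U) =
    chart_map i @` dom i `&` chart_inv i @^-1` U.
Proof.
case=> _ _ cK _ _; apply/seteqP; split=> [_ [p [ip Up] <-]|_ [[p ip <-] Up]].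
  by split; [exists p|rewrite /= cK ?inE].
by exists p => //; split=> //; move: Up; rewrite /= cK ?inE.
Qed.

Lemma open_chart_map_image i (U : set M) :
  is_chart i -> open U -> open (chart_map i @` (dom i `&` U)).
Proof.
move=> ci oU; rewrite chart_map_image //; have [_ oi _ _ cinv] := ci.
rewrite openE => x [ix Ux]; apply: filterI; first exact: open_nbhs_nbhs.
by apply: (cinv x); [rewrite inE|exact: open_nbhs_nbhs].
Qed.

End Charts.

Section Product.
Variables (R : realType) (m1 m2 : nat).
Variables (M1 : charted_space R m1) (M2 : charted_space R m2).
Hypotheses (man1 : is_manifold M1) (man2 : is_manifold M2).
Local Notation M := (product_space M1 M2).

(** The product A1 x A2, once rows of length m1 + m2 are identified with pairs of rows. *)
Definition lr_preimage (A1 : set 'rV[R]_m1) (A2 : set 'rV[R]_m2) :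
  set 'rV[R]_(m1 + m2) := lsubmx @^-1` A1 `&` rsubmx @^-1` A2.

Lemma open_lr_preimage A1 A2 :
  open A1 -> open A2 -> open (lr_preimage A1 A2).
Proof.
move=> oA1 oA2; apply: openI.
  by apply: open_comp => // v _; exact: continuous_lsubmx.
by apply: open_comp => // v _; exact: continuous_rsubmx.
Qed.

Lemma product_chart_image (i : chart M) U1 U2 :
  chart_map i @` (U1 `*` U2) =
    lr_preimage (chart_map i.1 @` U1) (chart_map i.2 @` U2).
Proof.
apply/seteqP; split=> [_ [[p1 p2] [/= U1p U2p] <-]|v [[p1 U1p p1v] [p2 U2p p2v]]].
  by split; rewrite /= ?row_mxKl ?row_mxKr; [exists p1|exists p2].
by exists (p1, p2) => //=; rewrite p1v p2v hsubmxK.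
Qed.

Lemma Ck_lsub (V : normedModType R) k A1 A2 (f : 'rV[R]_m1 -> V) :
  Ck k A1 f -> Ck k (lr_preimage A1 A2) (f \o lsubmx).
Proof.
move=> Cf; apply: (@sub_Ck _ _ _ _ (lsubmx @^-1` A1)); first exact: subIsetl.
by apply: Ck_comp_linear => //; exact: continuous_lsubmx.
Qed.

Lemma Ck_rsub (V : normedModType R) k A1 A2 (f : 'rV[R]_m2 -> V) :
  Ck k A2 f -> Ck k (lr_preimage A1 A2) (f \o rsubmx).
Proof.
move=> Cf; apply: (@sub_Ck _ _ _ _ (rsubmx @^-1` A2)); first exact: subIsetr.
by apply: Ck_comp_linear => //; exact: continuous_rsubmx.
Qed.

Lemma product_transition (i j : chart M) v : transition i j v =
  row_mx (transition i.1 j.1 (lsubmx v)) (transition i.2 j.2 (rsubmx v)).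
Proof. by []. Qed.

Lemma product_is_chart (i : chart M) : is_chart i.
Proof.
have [_ _ _ /(_ i.1)[oD1 oI1 K1 c1 v1] _] := man1.
have [_ _ _ /(_ i.2)[oD2 oI2 K2 c2 v2] _] := man2.
split.
- exact: openX.
- by rewrite product_chart_image; exact: open_lr_preimage.
- move=> [p1 p2] /set_mem[/= ip1 ip2].
  by rewrite row_mxKl row_mxKr K1 ?K2 ?inE.
- move=> p /set_mem[ip1 ip2]; apply: mx_continuous_at => a b.
  case: (split_ordP b) => l ->.
    have -> : (fun y => chart_map i y a (lshift m2 l)) =
        (fun v : 'rV[R]_m1 => v a l) \o (chart_map i.1 \o fst).
      by apply/funext => y; rewrite /= row_mxEl.
    apply: continuous_comp; last exact: coord_continuous.
    by apply: continuous_comp; [exact: cvg_fst|apply: c1; rewrite inE].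
  have -> : (fun y => chart_map i y a (rshift m1 l)) =
      (fun v : 'rV[R]_m2 => v a l) \o (chart_map i.2 \o snd).
    by apply/funext => y; rewrite /= row_mxEr.
  apply: continuous_comp; last exact: coord_continuous.
  by apply: continuous_comp; [exact: cvg_snd|apply: c2; rewrite inE].
- move=> v; rewrite product_chart_image => /set_mem[/= iv1 iv2].
  apply: (@continuous_pair_at _ _ _ (chart_inv i.1 \o lsubmx)
    (chart_inv i.2 \o rsubmx)).
    by apply: continuous_comp; [exact: continuous_lsubmx|apply: v1; rewrite inE].
  by apply: continuous_comp; [exact: continuous_rsubmx|apply: v2; rewrite inE].
Qed.

Lemma product_is_manifold : is_manifold M.
Proof.
have [h1 s1 cov1 ch1 tr1] := man1; have [h2 s2 cov2 ch2 tr2] := man2.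
split.
- exact: hausdorff_prod.
- exact: second_countable_prod.
- move=> [p1 p2]; have [i1 ip1] := cov1 p1; have [i2 ip2] := cov2 p2.
  by exists (i1, i2).
- exact: product_is_chart.
- move=> i j k.
  rewrite (_ : dom i `&` dom j =
    (dom i.1 `&` dom j.1) `*` (dom i.2 `&` dom j.2)); last first.
    by apply/seteqP; split=> [p [[? ?] [? ?]]|p [[? ?] [? ?]]]; split; split.
  rewrite product_chart_image.
  have oD1 : open (dom j.1) by have [] := ch1 j.1.
  have oD2 : open (dom j.2) by have [] := ch2 j.2.
  have oI := open_lr_preimage (open_chart_map_image (ch1 i.1) oD1)
    (open_chart_map_image (ch2 i.2) oD2).
  apply: (@Ck_row_mx _ _ _ _ _ _ _ (transition i.1 j.1 \o lsubmx)
    (transition i.2 j.2 \o rsubmx)) => //.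
    exact: (Ck_lsub _ (tr1 i.1 j.1 k)).
  exact: (Ck_rsub _ (tr2 i.2 j.2 k)).
Qed.

End Product.

(** * The half-line and the circle *)

(** The constant c may change with x, as it does on the overlap of two charts of the circle, which
    can be disconnected; the derivative along v is nevertheless the constant v on all of U. *)
Lemma near_translation_smooth (R : realType) m (U : set 'rV[R]_m)
    (f : 'rV[R]_m -> 'rV[R]_m) :
  open U -> (forall x, U x -> exists c, \forall v \near x, f v = v + c) ->
  smooth U f.
Proof.
move=> oU fU.
have dadd c x : differentiable (fun v : 'rV[R]_m => v + c) x.
  by apply: differentiableD => //; exact: differentiable_cst.
have df x : U x -> differentiable f x.
  move=> /fU[c fc]; apply: near_eq_differentiable (dadd c x).
  by apply: filterS fc => v ->.
apply/smoothP; split=> // v k; apply: eq_Ck oU _ (Ck_cst k U v).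
move=> x /set_mem /fU[c fc]; rewrite /cst.
rewrite (near_eq_derive (g := fun v => v + c)) // deriveD //.
by rewrite derive_id derive_cst addr0.
Qed.

(* The transitions preserve dt, and the functions cos 2t and sin 2t are defined
   on the whole base. *)
Definition angular_coordinate (R : realType) (B : charted_space R 1) : Prop :=
  forall i j (p : B), dom i p -> dom j p ->
  [/\ exists c, \forall v \near chart_map i p, transition i j v = v + c,
      cos (2 * chart_map i p 0 0) = cos (2 * chart_map j p 0 0) &
      sin (2 * chart_map i p 0 0) = sin (2 * chart_map j p 0 0)].

Section AngularBase.
Variables (R : realType) (B : charted_space R 1).

Lemma angular_manifold : hausdorff_space B -> @second_countable B ->
  (forall p : B, exists i, dom i p) -> (forall i : chart B, is_chart i) ->
  angular_coordinate B -> is_manifold B.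
Proof.
move=> hB sB cB chB aB; split=> // i j; apply: near_translation_smooth.
  by apply: open_chart_map_image; [exact: chB|have [] := chB j].
by move=> _ [p [ip jp] <-]; have [] := aB _ _ _ ip jp.
Qed.

End AngularBase.

Section PositiveLine.
Variable R : realType.
Local Notation L := (positive_line R).

Lemma set_val_gt0 (t : set_type (@posR R)) : 0 < set_val t.
Proof. by have := set_valP t; rewrite set_valE. Qed.

Lemma positive_line_map_image (i : chart L) :
  chart_map i @` dom i = [set v | 0 < v 0 0].
Proof.
apply/seteqP; split=> [_ [t _ <-]|v v0] /=.
  by rewrite mxE; exact: set_val_gt0.
have pv : v 0 0 \in @posR R by rewrite inE.
exists (exist _ (v 0 0) pv : set_type (@posR R)) => //.
by apply/rowP => l; rewrite mxE ord1.
Qed.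

Lemma set_val_insubd (t : R) (x : set_type (@posR R)) :
  0 < t -> set_val (insubd x t) = t.
Proof. by move=> t0; rewrite set_valE insubdK // inE. Qed.

Lemma positive_line_is_chart (i : chart L) : is_chart i.
Proof.
have oI : open [set v : 'rV[R]_1 | 0 < v 0 0].
  apply: (open_comp (f := fun v : 'rV[R]_1 => v 0 0) (D := [set t | 0 < t])).
    by move=> v _; exact: coord_continuous.
  exact: open_gt.
split.
- exact: openT.
- by rewrite positive_line_map_image.
- move=> t _; rewrite /= mxE; apply: val_inj.
  by rewrite -!set_valE set_val_insubd //; exact: set_val_gt0.
- move=> t _; apply: continuous_comp; last exact: const_mx_continuous.
  exact: initial_continuous.
- move=> v; rewrite positive_line_map_image => /set_mem v0.
  move=> A [_ [[W oW <-] Wv] sWA].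
  (* Positivity is imposed together with W because [insubd] inverts [set_val] only at positive reals
     and returns a default value elsewhere. *)
  have nW : \forall w \near v, W ((w : 'rV[R]_1) 0 0) /\ 0 < w 0 0.
    apply: filterI; last by apply: open_nbhs_nbhs; split.
    apply: coord_continuous; apply: open_nbhs_nbhs; split=> //.
    by move: Wv; rewrite /= set_val_insubd.
  apply: filterS nW => w [Ww w0]; apply: sWA.
  by rewrite /= set_val_insubd.
Qed.

Lemma positive_line_angular : angular_coordinate L.
Proof.
move=> i j p _ _; split=> //; exists 0.
have : \forall v \near chart_map i p, (chart_map i @` dom i) v.
  apply: open_nbhs_nbhs; split; last by exists p.
  by have [] := positive_line_is_chart i.
apply: filterS => v; rewrite positive_line_map_image => v0.
rewrite addr0 /transition /=; apply/rowP => l.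
by rewrite mxE set_val_insubd // ord1.
Qed.

Lemma positive_line_manifold : is_manifold L.
Proof.
apply: angular_manifold; last exact: positive_line_angular.
- apply: (@hausdorff_injective _ R set_val); last exact: Rhausdorff.
    exact: initial_continuous.
  by move=> s t; rewrite !set_valE => /val_inj.
- exact: second_countable_initial (second_countable_real R).
- by move=> p; exists tt.
- exact: positive_line_is_chart.
Qed.

End PositiveLine.

Section Circle.
Variable R : realType.
Local Notation C := (circle R).
Local Notation pi := (@pi R).

Lemma angle_ofP (s t : R) :
  angle_of s = angle_of t <-> exists k : int, s - t = k%:~R * (2 * pi).
Proof.
split=> [/eqmodP /asboolP //|st].
by apply/eqmodP/asboolP.
Qed.

Lemma angle_of_surj (x : C) : exists t, x = angle_of t.
Proof. by exists (repr x); rewrite /angle_of reprK. Qed.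

Lemma angle_of_continuous : continuous (@angle_of R).
Proof. exact: pi_continuous. Qed.

Lemma periodicz (f : R -> R) (T : R) (k : int) (a : R) :
  periodic f T -> f (a + k%:~R * T) = f a.
Proof.
move=> fT; case: k => l; first by rewrite -(periodicn fT l a) mulr_natl.
rewrite NegzE mulrNz mulNr -(periodicn fT l.+1) -[T *+ _]mulr_natl.
by rewrite -[l.+1%:~R]/(l.+1%:R) subrK.
Qed.

(** The discreteness of 2 pi Z, in the form on which both the injectivity of [angle_of] on a chart
    interval and the separation of points rest. *)
Lemma int_mul2pi_eq0 (k : int) : `|k%:~R * (2 * pi)| < 2 * pi -> k = 0.
Proof.
have pi0 := pi_gt0 R; rewrite normrM (gtr0_norm (x := 2 * pi)); last lra.
rewrite gtr_pMl; last lra.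
rewrite -intr_norm -[1]/(1%:~R) ltr_int => k1.
by apply/eqP; rewrite -normr_eq0; move: k1 (normr_ge0 k); lia.
Qed.

Lemma angle_of_inj (a s t : R) : a < s < a + 2 * pi -> a < t < a + 2 * pi ->
  angle_of s = angle_of t -> s = t.
Proof.
move=> /andP[as1 sa] /andP[at1 ta] /angle_ofP[k st].
have k0 : k = 0 by apply: int_mul2pi_eq0; rewrite -st ltr_norml; apply/andP; split; lra.
by move: st; rewrite k0 mul0r; lra.
Qed.

(** The saturation of U is the union of its translates by multiples of 2 pi, each of them open. *)
Lemma angle_of_open (U : set R) : open U -> open (@angle_of R @` U).
Proof.
move=> oU; rewrite /open /= /quotient_open.
rewrite (_ : _ @^-1` _ =
    \bigcup_(k in [set: int]) (fun t => t + k%:~R * (2 * pi)) @^-1` U).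
  apply: bigcup_open => k _; apply: open_comp => // t _.
  by apply: cvgD; [exact: cvg_id|exact: cvg_cst].
apply/seteqP; split=> [t [s Us /angle_ofP[k st]]|t [k _ Ut]].
  by exists k => //; rewrite /= -st addrC subrK.
by exists (t + k%:~R * (2 * pi)) => //; apply/angle_ofP; exists k; lra.
Qed.

Lemma ex_angle_between (a t : R) : exists k : int,
  a <= t + k%:~R * (2 * pi) < a + 2 * pi.
Proof.
have pi0 := pi_gt0 R; have pi2 : 0 < 2 * pi by lra.
(* Minus the number of whole turns from a to t. *)
exists (- Num.floor ((t - a) / (2 * pi))).
set q := (t - a) / (2 * pi).
have tq : t - a = q * (2 * pi) by rewrite divfK // gt_eqF.
have /andP[fq1 fq2] := mem_rg1_floor q.
have h1 : (Num.floor q)%:~R * (2 * pi) <= q * (2 * pi) by rewrite ler_pM2r.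
have h2 : q * (2 * pi) < ((Num.floor q)%:~R + 1) * (2 * pi) by rewrite ltr_pM2r.
by rewrite mulrNz; apply/andP; split; lra.
Qed.

Lemma circle_hausdorff : hausdorff_space C.
Proof.
have pi0 := pi_gt0 R.
move=> x y clxy; apply: contrapT => nxy.
have [s xs] := angle_of_surj x; have [t0 yt0] := angle_of_surj y.
have [k /andP[st ts]] := ex_angle_between s t0.
set t := t0 + _ in st ts.
have yt : y = angle_of t.
  by rewrite yt0; apply/angle_ofP; exists (- k); rewrite mulrNz /t; lra.
have nst : s != t by apply/eqP => e; apply: nxy; rewrite xs yt e.
have {}st : s < t by rewrite lt_neqAle nst.
(* Half the length of the shorter arc between x and y. For u and v within e of s and t, the
   difference v - u then lies strictly between 0 and 2 pi, so u and v cannot define the same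
   angle. *)
pose e := Num.min (t - s) (s + 2 * pi - t) / 2.
have e1 : 2 * e <= t - s by rewrite /e mulrCA divff // mulr1 ge_min lexx.
have e2 : 2 * e <= s + 2 * pi - t.
  by rewrite /e mulrCA divff // mulr1 ge_min lexx orbT.
have e0 : 0 < e by rewrite divr_gt0 // lt_min; apply/andP; split; lra.
have nb (u : R) : nbhs (angle_of u : C) (@angle_of R @` ball u e).
  apply: open_nbhs_nbhs; split; last by exists u => //; exact: ballxx.
  by apply: angle_of_open; exact: ball_open.
have := clxy (@angle_of R @` ball s e) (@angle_of R @` ball t e).
rewrite {1}xs {1}yt => /(_ (nb s) (nb t))[z [[u us uz] [v vt vz]]].
move: us vt; rewrite /ball /= !ltr_norml => /andP[us1 us2] /andP[vt1 vt2].
have /angle_ofP[l uvl] : angle_of v = angle_of u by rewrite uz vz.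
have l0 : l = 0.
  by apply: int_mul2pi_eq0; rewrite -uvl ltr_norml; apply/andP; split; lra.
by move: uvl; rewrite l0 mul0r; lra.
Qed.

Lemma circle_compact : compact [set: C].
Proof.
have -> : [set: C] = @angle_of R @` `[0, 2 * pi]%classic.
  apply/seteqP; split=> // x _; have [t0 xt0] := angle_of_surj x.
  have [k /andP[h1 h2]] := ex_angle_between 0 t0.
  exists (t0 + k%:~R * (2 * pi)).
    by rewrite /= in_itv /= h1 /=; move: h2; rewrite add0r => /ltW.
  by rewrite xt0; apply/angle_ofP; exists k; lra.
apply: continuous_compact; last exact: segment_compact.
exact/continuous_subspaceT/angle_of_continuous.
Qed.

(** The set given to [xget] contains t, and only t by injectivity on the interval, so the default
    value a is never returned. *)
Lemma circle_mapK (a t : R) : a < t < a + 2 * pi ->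
  chart_map (a : chart C) (angle_of t) = const_mx t.
Proof.
move=> ta; congr const_mx.
have [sa st] := @xgetPex _ a
  [set s : R | a < s < a + 2 * pi /\ angle_of s = angle_of t]
  (ex_intro _ t (conj ta erefl)).
exact: angle_of_inj sa ta st.
Qed.

Lemma circle_map_image (a : chart C) :
  chart_map a @` dom a = [set v | (a : R) < v 0 0 < (a : R) + 2 * pi].
Proof.
apply/seteqP; split=> [_ [_ [t ta <-] <-]|v va].
  by rewrite circle_mapK //= mxE.
exists (angle_of (v 0 0)); first by exists (v 0 0).
by rewrite circle_mapK //; apply/rowP => l; rewrite mxE ord1.
Qed.

Lemma open_itv (a b : R) : open [set t : R | a < t < b].
Proof.
rewrite (_ : [set _ | _] = `]a, b[%classic); first exact: interval_open.
by apply/seteqP; split=> t; rewrite /= in_itv.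
Qed.

Lemma open_coord_itv (a b : R) : open [set v : 'rV[R]_1 | a < v 0 0 < b].
Proof.
apply: (open_comp (f := fun v : 'rV[R]_1 => v 0 0) (D := [set t | a < t < b])).
  by move=> v _; exact: coord_continuous.
exact: open_itv.
Qed.

Lemma circle_is_chart (a : chart C) : is_chart a.
Proof.
have oJ : open [set t : R | (a : R) < t < (a : R) + 2 * pi].
  exact: open_itv.
split.
- exact: angle_of_open.
- by rewrite circle_map_image; exact: open_coord_itv.
- by move=> _ /set_mem[t ta <-]; rewrite circle_mapK //= mxE.
- move=> _ /set_mem[t ta <-] A; rewrite circle_mapK // => nA.
  (* The preimage of A in the interval is only known to be a neighbourhood of t; its interior is
     taken so that [angle_of_open] applies. *)
  have /nbhs_interior nB : nbhs t (const_mx @^-1` A `&`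
      [set t : R | (a : R) < t < (a : R) + 2 * pi]).
    by apply: filterI; [exact: (const_mx_continuous nA)|exact: open_nbhs_nbhs].
  have : nbhs (angle_of t : C) (@angle_of R @` (const_mx @^-1` A `&`
      [set t : R | (a : R) < t < (a : R) + 2 * pi])°).
    apply: open_nbhs_nbhs; split; first exact/angle_of_open/open_interior.
    by exists t => //; exact: nbhs_singleton.
  apply: filterS => _ [s /interior_subset[As sa] <-].
  by change (A (chart_map a (angle_of s))); rewrite circle_mapK.
- move=> v _; apply: (@continuous_comp _ _ _ (fun v : 'rV[R]_1 => v 0 0)).
    exact: coord_continuous.
  exact: angle_of_continuous.
Qed.

Lemma circle_angular : angular_coordinate C.
Proof.
move=> a b p [s sa sp] [t tb tp].
have /angle_ofP[k tsk] : angle_of t = angle_of s by rewrite sp tp.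
rewrite -{1 2 4}sp -tp !circle_mapK // !mxE.
have per (f : R -> R) : periodic f (pi *+ 2) -> f (2 * s) = f (2 * t).
  move=> fper; have -> : 2 * t = 2 * s + (2 * k)%:~R * (pi *+ 2).
    by rewrite intrM mulr2n; lra.
  by rewrite periodicz.
split; last 2 first.
- exact/per/cosD2pi.
- exact/per/sinD2pi.
exists (const_mx (k%:~R * (2 * pi))).
(* The interval of the chart b, moved back by k turns: for such v, the number v + 2 k pi is the
   representative that the chart b selects. *)
have : \forall v \near (const_mx s : 'rV[R]_1),
    (b : R) - k%:~R * (2 * pi) < (v : 'rV[R]_1) 0 0 <
    (b : R) + 2 * pi - k%:~R * (2 * pi).
  apply: open_nbhs_nbhs; split; first exact: open_coord_itv.
  by move: tb; rewrite /= mxE -tsk => /andP[h1 h2]; apply/andP; split; lra.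
apply: filterS => v /andP[vb1 vb2].
have e : angle_of (v 0 0) = angle_of (v 0 0 + k%:~R * (2 * pi)).
  by apply/esym/angle_ofP; exists k; lra.
rewrite -[transition a b v]/(chart_map (b : chart C) (angle_of (v 0 0))) e.
rewrite circle_mapK; last by apply/andP; split; lra.
by apply/rowP => l; rewrite !mxE ord1.
Qed.

Lemma circle_manifold : is_manifold C.
Proof.
have pi0 := pi_gt0 R.
apply: angular_manifold; last exact: circle_angular.
- exact: circle_hausdorff.
- apply: (@second_countable_open_image R _ (@angle_of R)).
  + exact: angle_of_continuous.
  + exact: angle_of_open.
  + apply/seteqP; split=> // x _.
    by have [t ->] := angle_of_surj x; exists t.
  + exact: second_countable_real.
(* The interval of the chart of index t - pi has t as its midpoint. *)
- move=> p; have [t ->] := angle_of_surj p; exists (t - pi).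
  by exists t => //=; apply/andP; split; lra.
- exact: circle_is_chart.
Qed.

End Circle.

(** * Differentiation in charts *)

Section DeriveMatrix.
Variables (R : realType) (V : normedModType R).
Implicit Types x v : V.

Lemma derive_row_mx m n1 n2 (f : V -> 'M[R]_(m, n1)) (g : V -> 'M[R]_(m, n2))
    x v : derivable f x v -> derivable g x v ->
  'D_v (fun y => row_mx (f y) (g y)) x = row_mx ('D_v f x) ('D_v g x).
Proof.
move=> df dg; have dfg : derivable (fun y => row_mx (f y) (g y)) x v.
  apply/derivable_mxP => i j; case: (split_ordP j) => l ->.
    by under eq_fun do rewrite row_mxEl; exact: (derivable_mxP _ _ _).1.
  by under eq_fun do rewrite row_mxEr; exact: (derivable_mxP _ _ _).1.
rewrite !derive_mx //; apply/matrixP => i j; rewrite mxE.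
case: (split_ordP j) => l ->.
  by rewrite row_mxEl mxE; under eq_fun do rewrite row_mxEl.
by rewrite row_mxEr mxE; under eq_fun do rewrite row_mxEr.
Qed.

(** Jacobians, phi and the metric of the cylinder vary at most in their lower right block. *)
Lemma derive_block_dr m1 m2 n1 n2 (A : 'M[R]_(m1, n1)) (B : 'M[R]_(m1, n2))
    (C : 'M[R]_(m2, n1)) (f : V -> 'M[R]_(m2, n2)) x v : derivable f x v ->
  'D_v (fun y => block_mx A B C (f y)) x = block_mx 0 0 0 ('D_v f x).
Proof.
move=> df; have dF : derivable (fun y => block_mx A B C (f y)) x v.
  apply/derivable_mxP => i j.
  case: (split_ordP i) => i' ->; case: (split_ordP j) => j' ->.
  - by under eq_fun do rewrite block_mxEul; exact: derivable_cst.
  - by under eq_fun do rewrite block_mxEur; exact: derivable_cst.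
  - by under eq_fun do rewrite block_mxEdl; exact: derivable_cst.
  - by under eq_fun do rewrite block_mxEdr; exact: (derivable_mxP _ _ _).1.
rewrite (derive_mx dF) (derive_mx df); apply/matrixP => i j; rewrite mxE.
case: (split_ordP i) => i' ->; case: (split_ordP j) => j' ->.
- by rewrite block_mxEul mxE; under eq_fun do rewrite block_mxEul;
    exact: derive_cst.
- by rewrite block_mxEur mxE; under eq_fun do rewrite block_mxEur;
    exact: derive_cst.
- by rewrite block_mxEdl mxE; under eq_fun do rewrite block_mxEdl;
    exact: derive_cst.
- by rewrite block_mxEdr mxE; under eq_fun do rewrite block_mxEdr.
Qed.

Lemma derivable_mulmx m n p (f : V -> 'M[R]_(m, n)) (g : V -> 'M[R]_(n, p))
    x v : derivable f x v -> derivable g x v ->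
  derivable (fun y => f y *m g y) x v.
Proof.
move=> df dg; apply/derivable_mxP => i j.
rewrite (_ : (fun y => (f y *m g y) i j) =
    \sum_l ((fun y => f y i l) * (fun y => g y l j))); last first.
  by apply/funext => y; rewrite mxE fct_sumE.
apply: derivable_sum => l; apply: derivableM; exact: (derivable_mxP _ _ _).1.
Qed.

Lemma derive_mulmx m n p (f : V -> 'M[R]_(m, n)) (g : V -> 'M[R]_(n, p)) x v :
  derivable f x v -> derivable g x v ->
  'D_v (fun y => f y *m g y) x = 'D_v f x *m g x + f x *m 'D_v g x.
Proof.
move=> df dg; rewrite !derive_mx //; last exact: derivable_mulmx.
apply/matrixP => i j; rewrite !mxE -big_split /=.
rewrite (_ : (fun y => (f y *m g y) i j) =
    \sum_l ((fun y => f y i l) * (fun y => g y l j))); last first.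
  by apply/funext => y; rewrite mxE fct_sumE.
have dfe l : derivable (fun y => f y i l) x v by exact: (derivable_mxP _ _ _).1.
have dge l : derivable (fun y => g y l j) x v by exact: (derivable_mxP _ _ _).1.
rewrite derive_sum => [|l]; last exact: derivableM.
apply: eq_bigr => l _; rewrite deriveM // !mxE addrC /GRing.scale /=.
by congr (_ + _); rewrite mulrC.
Qed.

Lemma derive_scalel (W : normedModType R) (f : V -> R) (w : W) x v :
  differentiable f x -> 'D_v (fun y => f y *: w) x = 'D_v f x *: w.
Proof.
by move=> df; rewrite !deriveE ?diffZl //; exact: differentiableZl.
Qed.

(** Moving along (v, 0) leaves the right block of x fixed, so the difference quotients coincide. *)
Lemma derive_row_mxl m1 m2 (W : normedModType R)
    (f : 'rV[R]_(m1 + m2) -> W) (x : 'rV[R]_(m1 + m2)) (v : 'rV[R]_m1) :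
  'D_(row_mx v 0) f x = 'D_v (fun u => f (row_mx u (rsubmx x))) (lsubmx x).
Proof.
rewrite /derive; set d := (fun _ : R => _); set d' := (fun _ : R => _).
suff -> : d = d' by []; apply/funext => t; rewrite /d /d' /= hsubmxK.
by rewrite -{1}(hsubmxK x) scale_row_mx add_row_mx scaler0 add0r.
Qed.

Lemma derive_row_mxr m1 m2 (W : normedModType R)
    (f : 'rV[R]_(m1 + m2) -> W) (x : 'rV[R]_(m1 + m2)) (v : 'rV[R]_m2) :
  'D_(row_mx 0 v) f x = 'D_v (fun u => f (row_mx (lsubmx x) u)) (rsubmx x).
Proof.
rewrite /derive; set d := (fun _ : R => _); set d' := (fun _ : R => _).
suff -> : d = d' by []; apply/funext => t; rewrite /d /d' /= hsubmxK.
by rewrite -{1}(hsubmxK x) scale_row_mx add_row_mx scaler0 add0r.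
Qed.

End DeriveMatrix.

Lemma delta_mx_lshift (R : nzRingType) m1 m2 (a : 'I_m1) :
  delta_mx 0 (lshift m2 a) = row_mx (delta_mx 0 a) 0 :> 'rV[R]_(m1 + m2).
Proof.
apply/rowP => b; case: (split_ordP b) => l ->;
by rewrite ?row_mxEl ?row_mxEr !mxE /= ?(inj_eq (@lshift_inj _ _)) ?eq_rlshift.
Qed.

Lemma delta_mx_rshift (R : nzRingType) m1 m2 (a : 'I_m2) :
  delta_mx 0 (rshift m1 a) = row_mx 0 (delta_mx 0 a) :> 'rV[R]_(m1 + m2).
Proof.
apply/rowP => b; case: (split_ordP b) => l ->;
by rewrite ?row_mxEl ?row_mxEr !mxE /= ?(inj_eq (@rshift_inj _ _)) ?eq_lrshift.
Qed.

Section ChartDerivatives.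
Variables (R : realType) (m : nat) (M : charted_space R m).
Hypothesis manM : is_manifold M.
Implicit Types i j : chart M.

(** Makes an identity between points of U hold for all coordinates near those of p, so that it can
    be differentiated in the chart. *)
Lemma near_chart_map i (U : set M) p : open U -> dom i p -> U p ->
  \forall v \near chart_map i p,
    [/\ dom i (chart_inv i v), U (chart_inv i v) &
        chart_map i (chart_inv i v) = v].
Proof.
have [_ _ _ ch _] := manM; have [_ _ cK _ _] := ch i => oU ip Up.
have : nbhs (chart_map i p) (chart_map i @` (dom i `&` U)).
  apply: open_nbhs_nbhs; split; last by exists p.
  exact: open_chart_map_image (ch i) oU.
by apply: filterS => _ [q [iq Uq] <-]; rewrite cK ?inE.
Qed.

Lemma near_chart_map2 i j p : dom i p -> dom j p ->
  \forall v \near chart_map i p,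
    [/\ dom i (chart_inv i v), dom j (chart_inv i v) &
        chart_map i (chart_inv i v) = v].
Proof.
have [_ _ _ ch _] := manM => ip jp.
by apply: near_chart_map => //; have [] := ch j.
Qed.

Lemma smooth_components_derivable (V : normedModType R) (f : components M V)
    i p v : smooth_components f -> dom i p ->
  derivable (f i \o chart_inv i) (chart_map i p) v.
Proof.
move=> sf ip; apply: diff_derivable; have [+ _] := sf i 1%N; apply.
by exists p.
Qed.

Lemma transition_differentiable i j p : dom i p -> dom j p ->
  differentiable (transition i j) (chart_map i p).
Proof.
have [_ _ _ _ tr] := manM => ip jp.
by have [+ _] := tr i j 1%N; apply; exists p.
Qed.

Lemma row_jac i j p (X : 'rV[R]_m) : dom i p -> dom j p ->
  X *m jac i j p = 'D_X (transition i j) (chart_map i p).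
Proof. by move=> ip jp; rewrite deriveEjacobian //; exact: transition_differentiable. Qed.

Lemma jac_derivable i j p v : dom i p -> dom j p ->
  derivable (fun u => jac i j (chart_inv i u)) (chart_map i p) v.
Proof.
move=> ip jp; apply/derivable_mxP => a b.
(* D is a first derivative of the transition map, itself derivable since that map is C^2. It agrees
   with the entry of the Jacobian only near the image of p, where [chart_map] undoes [chart_inv]. *)
pose D u := ('D_(delta_mx 0 a) (transition i j) u) 0 b.
have /near_eq_derivable : {near chart_map i p,
    D =1 (fun u => jac i j (chart_inv i u) a b)}.
  apply: filterS (near_chart_map2 ip jp) => u [iu ju uK].
  by rewrite /D -{1}uK -row_jac // -rowE mxE.
apply; have [_ _ _ _ tr] := manM.
have [_ ddt] := tr i j 2%N; have [dt _] := ddt (delta_mx 0 a).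
apply: (derivable_mxP _ _ _).1; apply: diff_derivable; apply: dt.
by exists p.
Qed.

End ChartDerivatives.

Section ProductDerivatives.
Variables (R : realType) (m1 m2 : nat).
Variables (M1 : charted_space R m1) (M2 : charted_space R m2).
Hypotheses (man1 : is_manifold M1) (man2 : is_manifold M2).
Local Notation M := (product_space M1 M2).
Implicit Types i j : chart M.

Lemma pderiv_lshift (V : normedModType R) (f : components M V) i (p : M) a :
  dom i p -> pderiv f i p (lshift m2 a) =
  pderiv (fun k q => f (k, i.2) (q, p.2)) i.1 p.1 a.
Proof.
have [_ _ _ /(_ i.2)[_ _ cK _ _] _] := man2.
case: i p cK => i1 i2 [p1 p2] /= cK [/= ip1 ip2].
rewrite /pderiv /= delta_mx_lshift derive_row_mxl row_mxKl row_mxKr.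
congr (derive _ _ _); apply/funext => u /=.
by rewrite row_mxKl row_mxKr cK ?inE.
Qed.

Lemma pderiv_rshift (V : normedModType R) (f : components M V) i (p : M) a :
  dom i p -> pderiv f i p (rshift m1 a) =
  pderiv (fun k q => f (i.1, k) (p.1, q)) i.2 p.2 a.
Proof.
have [_ _ _ /(_ i.1)[_ _ cK _ _] _] := man1.
case: i p cK => i1 i2 [p1 p2] /= cK [/= ip1 ip2].
rewrite /pderiv /= delta_mx_rshift derive_row_mxr row_mxKl row_mxKr.
congr (derive _ _ _); apply/funext => u /=.
by rewrite row_mxKl row_mxKr cK ?inE.
Qed.

(** Rows of the Jacobian are derivatives along basis vectors, and each basis vector is tangent to
    one factor. *)
Lemma product_jac i j (p : M) : dom i p -> dom j p ->
  jac i j p = block_mx (jac i.1 j.1 p.1) 0 0 (jac i.2 j.2 p.2).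
Proof.
move=> ip jp; have [ip1 ip2] := ip; have [jp1 jp2] := jp.
have manM := product_is_manifold man1 man2.
have d1 := transition_differentiable man1 ip1 jp1.
have d2 := transition_differentiable man2 ip2 jp2.
apply/row_matrixP => a; rewrite !rowE (row_jac manM) //.
case: (split_ordP a) => l ->.
  rewrite delta_mx_lshift mul_row_block !mulmx0 mul0mx !addr0 derive_row_mxl.
  under eq_fun do rewrite product_transition row_mxKl row_mxKr.
  rewrite derive_row_mx; last exact: derivable_cst.
    by rewrite derive_cst /= row_mxKl (row_jac man1).
  by rewrite /= row_mxKl; exact: diff_derivable.
rewrite delta_mx_rshift mul_row_block !mulmx0 mul0mx !add0r derive_row_mxr.
under eq_fun do rewrite product_transition row_mxKl row_mxKr.
rewrite derive_row_mx; first last.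
  by rewrite /= row_mxKr; exact: diff_derivable.
  exact: derivable_cst.
by rewrite derive_cst /= row_mxKr (row_jac man2).
Qed.

End ProductDerivatives.

Section Angular.
Variables (R : realType) (B : charted_space R 1).
Hypotheses (manB : is_manifold B) (angB : angular_coordinate B).

Lemma angular_jac (i j : chart B) p : dom i p -> dom j p -> jac i j p = 1%:M.
Proof.
move=> ip jp; apply/row_matrixP => a; rewrite !rowE (row_jac manB) // mulmx1.
have [[c tc] _ _] := angB ip jp.
rewrite (near_eq_derive (g := fun v => v + c)) // deriveD //.
by rewrite derive_id derive_cst addr0.
Qed.

(** Packaged as a linear map so that cos 2t and sin 2t fall under the rules for composition with a
    linear map. *)
Definition double_angle : 'rV[R]_1 -> R := fun v => 2 * v 0 0.

Lemma double_angle_is_linear : linear double_angle.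
Proof. by move=> a u v; rewrite /double_angle !mxE /GRing.scale /=; lra. Qed.

HB.instance Definition _ :=
  GRing.isLinear.Build _ _ _ _ double_angle double_angle_is_linear.

Lemma double_angle_continuous : continuous double_angle.
Proof.
move=> v; apply: (@continuous_comp _ _ _ (fun u : 'rV[R]_1 => u 0 0) ( *%R 2)).
  exact: coord_continuous.
exact: mulrl_continuous.
Qed.

Lemma derive_double_angle (f : R -> R) (x : 'rV[R]_1) : differentiable f (2 * x 0 0) ->
  'D_(delta_mx 0 0) (fun v : 'rV[R]_1 => f (2 * v 0 0)) x = 2 * 'D_1 f (2 * x 0 0).
Proof.
move=> df; have d2 : double_angle (delta_mx 0 0) = 2.
  by rewrite /double_angle mxE !eqxx mulr1.
rewrite -[LHS]/('D_(delta_mx 0 0) (f \o double_angle) x).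
rewrite derive_comp_linear /= d2 !deriveE //.
by rewrite -[in LHS](mulr1 2) -[2 * 1]/(2 *: (1 : R)) linearZ.
Qed.

End Angular.

(** * The cylinder *)

Lemma sum_block_mx (R : nmodType) (I : Type) (r : seq I) m1 m2 n1 n2
    (A : I -> 'M[R]_(m1, n1)) (B : I -> 'M[R]_(m1, n2))
    (C : I -> 'M[R]_(m2, n1)) (D : I -> 'M[R]_(m2, n2)) :
  \sum_(i <- r) block_mx (A i) (B i) (C i) (D i) =
  block_mx (\sum_(i <- r) A i) (\sum_(i <- r) B i)
    (\sum_(i <- r) C i) (\sum_(i <- r) D i).
Proof.
elim: r => [|i r IHr]; first by rewrite !big_nil block_mx0.
by rewrite !big_cons IHr add_block_mx.
Qed.

(** Along N the coordinate t is frozen, so h_t is differentiated as a combination of h and J h with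
    constant coefficients. *)
Lemma derive_pencil (R : realType) (V : normedModType R) q r n
    (f : V -> 'M[R]_(q, r)) (g : V -> 'M[R]_(r, n)) (l : V -> 'M[R]_(q, n))
    (c s : R) x v :
  derivable f x v -> derivable g x v -> derivable l x v ->
  derivable (fun y => c *: l y - s *: (f y *m g y)) x v /\
  'D_v (fun y => c *: l y - s *: (f y *m g y)) x =
    c *: 'D_v l x - s *: ('D_v f x *m g x + f x *m 'D_v g x).
Proof.
move=> df dg dl; have dfg := derivable_mulmx df dg.
pose k y := f y *m g y.
have dcl : derivable (c \*: l) x v by exact: derivableZ.
have dsk : derivable (s \*: k) x v := derivableZ (k := s) dfg.
split; first exact: (derivableB dcl dsk).
rewrite -[LHS]/('D_v ((c \*: l) - (s \*: k)) x) (deriveB dcl dsk).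
by rewrite (deriveZ _ dl) (deriveZ _ dfg) (derive_mulmx df dg).
Qed.

(** * Signature under congruence and under adding a positive direction *)

Section Signature.
Variable R : realType.

Lemma has_signature_congr m r s (A H : 'M[R]_m) :
  A \in unitmx -> has_signature r s H -> has_signature r s (A *m H *m A^T).
Proof.
move=> uA [rs Hs [P uP PHP]]; split=> //.
  by rewrite !trmx_mul trmxK Hs mulmxA.
exists (P *m invmx A); first by rewrite unitmx_mul uP unitmx_inv.
rewrite trmx_mul -PHP !mulmxA mulmxKV // -!mulmxA; congr (_ *m (_ *m _)).
by rewrite mulmxA -trmx_mul mulVmx // trmx1 mul1mx.
Qed.

Lemma has_signature_block1 m r s (H : 'M[R]_m) : has_signature r s H ->
  @has_signature R (1 + m) r.+1 s (block_mx (1%:M : 'M[R]_1) 0 0 H).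
Proof.
move=> [rs Hs [P uP PHP]]; split.
- by rewrite addSn rs.
- by rewrite tr_block_mx !trmx0 trmx1 Hs.
exists (block_mx (1%:M : 'M[R]_1) 0 0 P).
  by rewrite unitmxE det_lblock det1 mul1r -unitmxE.
rewrite tr_block_mx !trmx0 trmx1 !mulmx_block.
rewrite !(mul0mx, mulmx0, mul1mx, mulmx1, addr0, add0r) PHP; apply/matrixP => i j.
case: (split_ordP i) => k ->; case: (split_ordP j) => l ->.
- by rewrite block_mxEul !mxE /= ord1 (ord1 l) /=.
- by rewrite block_mxEur !mxE eq_lrshift.
- by rewrite block_mxEdl !mxE eq_rlshift.
- by rewrite block_mxEdr !mxE (inj_eq (@rshift_inj _ _)).
Qed.

(** Turns h(J X, J Y) = - h(X, Y) into the matrix identity J h J^T = - h. *)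
Lemma bilinear_form_inj m (A C : 'M[R]_m) :
  (forall X Y : 'rV[R]_m, (X *m A *m Y^T) 0 0 = (X *m C *m Y^T) 0 0) -> A = C.
Proof.
move=> AC; apply/matrixP => i j; have := AC (delta_mx 0 i) (delta_mx 0 j).
by rewrite -!rowE trmx_delta -!colE !mxE.
Qed.

End Signature.

Section SmoothComponents.
Variables (R : realType) (m : nat) (M : charted_space R m).
Hypothesis manM : is_manifold M.

Let oM (i : chart M) : open (chart_map i @` dom i).
Proof. by have [_ _ _ /(_ i)[]] := manM. Qed.

Lemma smooth_components_cst (V : normedModType R) (c : V) :
  @smooth_components R m M V (fun _ _ => c).
Proof. by move=> i k; exact: Ck_cst. Qed.

Lemma smooth_components_mulmx q r s (f : components M 'M[R]_(q, r))
    (g : components M 'M[R]_(r, s)) :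
  smooth_components f -> smooth_components g ->
  smooth_components (fun i p => f i p *m g i p).
Proof. by move=> sf sg i k; exact: (Ck_mulmx (@oM i) (sf i k) (sg i k)). Qed.

Lemma smooth_components_scale q r (c : components M R)
    (f : components M 'M[R]_(q, r)) :
  smooth_components c -> smooth_components f ->
  smooth_components (fun i p => c i p *: f i p).
Proof. by move=> sc sf i k; exact: (Ck_scalemx (@oM i) (sc i k) (sf i k)). Qed.

Lemma smooth_components_add (V : normedModType R) (f g : components M V) :
  smooth_components f -> smooth_components g ->
  smooth_components (fun i p => f i p + g i p).
Proof. by move=> sf sg i k; exact: (CkD (@oM i) (sf i k) (sg i k)). Qed.

Lemma smooth_components_opp q r (f : components M 'M[R]_(q, r)) :
  smooth_components f -> smooth_components (fun i p => - f i p).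
Proof.
move=> sf; rewrite (_ : (fun i p => - f i p) = fun i p => (-1) *: f i p).
  by apply: smooth_components_scale => //; exact: smooth_components_cst.
by apply/funext => i; apply/funext => p; rewrite scaleN1r.
Qed.

Lemma smooth_components_block q1 q2 r1 r2 (f : components M 'M[R]_(q1, r1))
    (g : components M 'M[R]_(q1, r2)) (k : components M 'M[R]_(q2, r1))
    (l : components M 'M[R]_(q2, r2)) :
  smooth_components f -> smooth_components g ->
  smooth_components k -> smooth_components l ->
  smooth_components (fun i p => block_mx (f i p) (g i p) (k i p) (l i p)).
Proof.
move=> sf sg sk sl i n.
exact: (Ck_block_mx (@oM i) (sf i n) (sg i n) (sk i n) (sl i n)).
Qed.

Lemma smooth_components_row q r (a : 'I_q) (f : components M 'M[R]_(q, r)) :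
  smooth_components f -> smooth_components (fun i p => row a (f i p)).
Proof.
move=> sf; rewrite (_ : (fun i p => row a (f i p)) =
    fun i p => (delta_mx 0 a : 'rV[R]_q) *m f i p).
  by apply: smooth_components_mulmx => //; exact: smooth_components_cst.
by apply/funext => i; apply/funext => p; rewrite rowE.
Qed.

Lemma smooth_components_col q r (a : 'I_r) (f : components M 'M[R]_(q, r)) :
  smooth_components f -> smooth_components (fun i p => col a (f i p)).
Proof.
move=> sf; rewrite (_ : (fun i p => col a (f i p)) =
    fun i p => f i p *m (delta_mx a 0 : 'cV[R]_r)).
  by apply: smooth_components_mulmx => //; exact: smooth_components_cst.
by apply/funext => i; apply/funext => p; rewrite colE.
Qed.

End SmoothComponents.

(** * Geometry of the metric dt^2 + h_t on B x N, for both bases at once *)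

Section CylinderGeometry.
Variables (R : realType) (m : nat).
Variables (B : charted_space R 1) (N : charted_space R m).
Variables (J h : components N 'M[R]_m) (Gamma : 'I_m -> components N 'M[R]_m).
Hypotheses (manB : is_manifold B) (angB : angular_coordinate B).
Hypothesis manN : is_manifold N.
Hypothesis endoJ : is_endomorphism J.
Hypothesis JJ : forall i p, dom i p -> J i p *m J i p = - 1%:M.
Hypothesis bilh : is_bilinear h.
Hypothesis hsym : forall i p, dom i p -> (h i p)^T = h i p.
Hypothesis hJ : forall i p, dom i p -> J i p *m h i p *m (J i p)^T = - h i p.
Hypothesis LC : is_levi_civita h Gamma.
Hypothesis parJ : forall i p a, dom i p ->
  pderiv J i p a = Gamma a i p *m J i p - J i p *m Gamma a i p.

Local Notation M := (product_space B N).
Implicit Types (i j : chart M) (p : M).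

Let manM : is_manifold M := product_is_manifold manB manN.

(** Multiply J h J^T = - h on the left by J and use J^2 = -1. *)
Lemma J_h k q : dom k q -> J k q *m h k q = h k q *m (J k q)^T.
Proof.
move=> kq; apply: oppr_inj.
by rewrite -mulmxN -hJ // !mulmxA JJ // mulNmx mul1mx mulNmx.
Qed.

Definition fiber_metric : components M 'M[R]_m := fun i p =>
  let t := chart_map i.1 p.1 0 0 in
  cos (2 * t) *: h i.2 p.2 - sin (2 * t) *: (J i.2 p.2 *m h i.2 p.2).

(** The associated metric h_t(J ., .) of h_t: it is minus half of the t-derivative of h_t and will
    be the d_t component of nabla_X Y. *)
Definition fiber_twin : components M 'M[R]_m := fun i p =>
  J i.2 p.2 *m fiber_metric i p.

(* In dimension 1 + m rather than (2 * n).+1, for the sake of block matrices. *)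
Definition cylinder_phi : components M 'M[R]_(1 + m) :=
  fun i p => block_mx (0 : 'M[R]_1) 0 0 (J i.2 p.2).

Definition cylinder_metric : components M 'M[R]_(1 + m) :=
  fun i p => block_mx (1%:M : 'M[R]_1) 0 0 (fiber_metric i p).

(* As d/dt g = - 2 g(J ., .) on N, nabla_t X = nabla_X d_t = - J X and
   nabla_X Y = nabla^N_X Y + g(J X, Y) d_t. *)
Definition cylinder_gamma (a : 'I_(1 + m)) : components M 'M[R]_(1 + m) :=
  fun i p => match fintype.split a with
  | inl _ => block_mx (0 : 'M[R]_1) 0 0 (- J i.2 p.2)
  | inr b => block_mx (0 : 'M[R]_1) (- row b (J i.2 p.2))
               (col b (fiber_twin i p)) (Gamma b i.2 p.2)
  end.

Lemma cylinder_gamma_l (a : 'I_1) :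
  cylinder_gamma (lshift m a) = fun i p => block_mx (0 : 'M[R]_1) 0 0 (- J i.2 p.2).
Proof. by rewrite /cylinder_gamma (unsplitK (inl a)). Qed.

Lemma cylinder_gamma_r (b : 'I_m) :
  cylinder_gamma (rshift 1 b) = fun i p => block_mx (0 : 'M[R]_1)
    (- row b (J i.2 p.2)) (col b (fiber_twin i p)) (Gamma b i.2 p.2).
Proof. by rewrite /cylinder_gamma (unsplitK (inr b)). Qed.

Lemma fiber_metric_sym i p : dom i p -> (fiber_metric i p)^T = fiber_metric i p.
Proof.
move=> [_ ip]; rewrite /fiber_metric linearB !linearZ /= trmx_mul hsym //.
by rewrite J_h.
Qed.

(** h_t is a combination of h and J h, and J is self-adjoint for both. *)
Lemma J_fiber_metric i p : dom i p ->
  fiber_metric i p *m (J i.2 p.2)^T = fiber_twin i p.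
Proof.
move=> [_ ip]; rewrite /fiber_twin /fiber_metric mulmxBl mulmxBr.
rewrite -!scalemxAl -!scalemxAr mulmxA JJ // hJ // J_h //.
by rewrite mulNmx mul1mx.
Qed.

Lemma fiber_twin_sym i p : dom i p -> (fiber_twin i p)^T = fiber_twin i p.
Proof. by move=> ip; rewrite trmx_mul fiber_metric_sym // J_fiber_metric. Qed.

Lemma J_fiber_twin i p : dom i p ->
  J i.2 p.2 *m fiber_twin i p = - fiber_metric i p.
Proof. by case=> _ ip; rewrite mulmxA JJ // mulNmx mul1mx. Qed.

Lemma cylinder_jac i j p : dom i p -> dom j p ->
  jac i j p = block_mx (1%:M : 'M[R]_1) 0 0 (jac i.2 j.2 p.2).
Proof.
move=> ip jp; rewrite product_jac //.
by case: ip jp => [ip _] [jp _]; rewrite angular_jac.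
Qed.

(** The chart of B enters only through cos 2t and sin 2t, which angular coordinates share; J h is
    bilinear because J commutes with the Jacobian. *)
Lemma fiber_metric_change i j p : dom i p -> dom j p ->
  fiber_metric i p =
    jac i.2 j.2 p.2 *m fiber_metric j p *m (jac i.2 j.2 p.2)^T.
Proof.
move=> [ip1 ip2] [jp1 jp2]; have [_ ec es] := angB ip1 jp1.
rewrite /fiber_metric ec es mulmxBr mulmxBl -!scalemxAr -!scalemxAl.
congr (_ *: _ - _ *: _); first exact: bilh.2.
by rewrite (bilh.2 _ _ _ ip2 jp2) !mulmxA (endoJ.2 _ _ _ ip2 jp2).
Qed.

Lemma fiber_twin_change i j p : dom i p -> dom j p ->
  fiber_twin i p = jac i.2 j.2 p.2 *m fiber_twin j p *m (jac i.2 j.2 p.2)^T.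
Proof.
move=> ip jp; rewrite /fiber_twin (fiber_metric_change ip jp) !mulmxA.
by case: ip jp => [_ ip] [_ jp]; rewrite (endoJ.2 _ _ _ ip jp).
Qed.

Lemma smooth_components_fiber (V : normedModType R) (f : components N V) :
  smooth_components f -> @smooth_components R (1 + m) M V (fun i p => f i.2 p.2).
Proof.
move=> sf i k; rewrite product_chart_image.
exact: (Ck_rsub _ (sf i.2 k)).
Qed.

Lemma smooth_components_angle (f : R -> R) : (forall k, Ck k setT f) ->
  @smooth_components R (1 + m) M R (fun i p => f (2 * chart_map i.1 p.1 0 0)).
Proof.
move=> sf i k; rewrite product_chart_image.
have [_ _ _ /(_ i.1) chB _] := manB; have [_ oB cK _ _] := chB.
have [_ _ _ /(_ i.2)[_ oN _ _ _] _] := manN.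
have := Ck_comp_linear (L := (@double_angle R)) (@double_angle_continuous R) (sf k).
move=> /(Ck_lsub (chart_map i.2 @` dom i.2)) fL.
(* The coordinate read at [chart_inv] is the given one only on the image of the chart, hence the
   detour through local equality. *)
apply: (eq_Ck (open_lr_preimage oB oN) _ (sub_Ck _ fL)).
  move=> v /set_mem[[q iq qv] _] /=; rewrite /double_angle.
  by rewrite -qv cK ?inE.
by apply: setSI.
Qed.

Lemma fiber_metric_smooth : smooth_components fiber_metric.
Proof.
have sh := bilh.1; have sJ := endoJ.1.
apply: (smooth_components_add manM).
  apply: (smooth_components_scale manM).
    by apply: smooth_components_angle => k; have [] := Ck_cos_sin R k.
  exact: smooth_components_fiber.
apply: (smooth_components_opp manM); apply: (smooth_components_scale manM).
  by apply: smooth_components_angle => k; have [] := Ck_cos_sin R k.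
by apply: (smooth_components_mulmx manM); exact: smooth_components_fiber.
Qed.

Lemma fiber_twin_smooth : smooth_components fiber_twin.
Proof.
apply: (smooth_components_mulmx manM); last exact: fiber_metric_smooth.
exact: (smooth_components_fiber endoJ.1).
Qed.

Lemma cylinder_phi_endomorphism : is_endomorphism cylinder_phi.
Proof.
split.
  apply: (smooth_components_block manM); try exact: smooth_components_cst.
  exact: (smooth_components_fiber endoJ.1).
move=> i j p ip jp; rewrite cylinder_jac // /cylinder_phi !mulmx_block.
rewrite !(mulmx0, mul0mx, addr0, add0r).
by case: ip jp => [_ ip] [_ jp]; rewrite (endoJ.2 _ _ _ ip jp).
Qed.

Lemma cylinder_xi_vector_field :
  @is_vector_field R (1 + m) M (fun _ _ => row_mx (1%:M : 'M[R]_1) 0).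
Proof.
split; first exact: smooth_components_cst.
move=> i j p ip jp; rewrite cylinder_jac // mul_row_block.
by rewrite !(mulmx0, mul0mx, addr0, add0r) mul1mx.
Qed.

Lemma cylinder_eta_one_form :
  @is_one_form R (1 + m) M (fun _ _ => col_mx (1%:M : 'M[R]_1) 0).
Proof.
split; first exact: smooth_components_cst.
move=> i j p ip jp; rewrite cylinder_jac // mul_block_col.
by rewrite !(mulmx0, mul0mx, addr0, add0r) mul1mx.
Qed.

Lemma cylinder_metric_bilinear : is_bilinear cylinder_metric.
Proof.
split.
  apply: (smooth_components_block manM); try exact: smooth_components_cst.
  exact: fiber_metric_smooth.
move=> i j p ip jp; rewrite cylinder_jac // /cylinder_metric tr_block_mx !mulmx_block.
rewrite !trmx0 trmx1 !(mulmx0, mul0mx, addr0, add0r) !mul1mx.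
by rewrite -fiber_metric_change.
Qed.

(* With A = cos t - sin t J, A h A^T = cos 2t h - sin 2t J h. *)
Lemma cylinder_metric_signature r s i p : dom i p ->
  has_signature r s (h i.2 p.2) ->
  @has_signature R (1 + m) r.+1 s (cylinder_metric i p).
Proof.
move=> [_ ip] sh; apply: has_signature_block1.
pose t := chart_map i.1 p.1 0 0.
pose A (c : R) := cos t *: 1%:M + c *: J i.2 p.2.
(* Entrywise forms, with c = cos t and s1 = sin t, of the two matrix identities below: (cos t - sin
   t J)(cos t + sin t J) = 1 for [rot], and the double-angle expansion of A h A^T for [rot2]. *)
have rot (c s1 d e : R) :
    c * (c * d) + c * (s1 * e) + (- s1 * (c * e) + - s1 * (s1 * - d)) =
    (c ^+ 2 + s1 ^+ 2) * d by ring.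
have rot2 (c s1 d e : R) :
    (c * c + s1 * - s1) * d + (s1 * c + c * s1) * - e =
    c * (c * d) + - s1 * (c * e) + (c * (- s1 * e) + - s1 * (- s1 * - d)).
  by ring.
have AA : A (- sin t) *m A (sin t) = 1%:M.
  rewrite /A mulmxDl !mulmxDr -!scalemxAl -!scalemxAr !mul1mx mulmx1 JJ //.
  have := cos2Dsin2 t => cs1; apply/matrixP => a b; rewrite !mxE.
  rewrite -[RHS]mul1r -[X in _ = X * _]cs1.
  exact: rot.
have -> : fiber_metric i p = A (- sin t) *m h i.2 p.2 *m (A (- sin t))^T.
  rewrite /fiber_metric -/t mulr_natl mulr2n cosD sinD.
  rewrite /A linearD !linearZ /= trmx1 mulmxDl mulmxDr !mulmxDl.
  rewrite -!scalemxAl -!scalemxAr !mul1mx !mulmx1 hJ // -J_h //.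
  (* J h is generalised to K on the next line, to keep its entries from being expanded into sums. *)
  apply/matrixP => a b; rewrite [LHS]mxE [RHS]mxE.
  move: (J _ _ *m _) => K; rewrite !mxE; exact: rot2.
by apply: has_signature_congr => //; have [] := mulmx1_unit AA.
Qed.

(** * The Levi-Civita connection of the cylinder *)

Lemma cylinder_gamma_smooth a : smooth_components (cylinder_gamma a).
Proof.
have [[sG _] _ _] := LC; have sJ := endoJ.1.
case: (split_ordP a) => b ->.
  rewrite cylinder_gamma_l.
  apply: (smooth_components_block manM); try exact: smooth_components_cst.
  by apply: (smooth_components_opp manM); exact: smooth_components_fiber.
rewrite cylinder_gamma_r.
apply: (smooth_components_block manM); first exact: smooth_components_cst.
- apply: (smooth_components_opp manM); apply: (smooth_components_row manM).
  exact: smooth_components_fiber.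
- apply: (smooth_components_col manM); exact: fiber_twin_smooth.
- exact: smooth_components_fiber.
Qed.

Lemma pderiv_cylinder_jac_l i j p (a : 'I_1) : dom i p -> dom j p ->
  pderiv (fun k => jac k j) i p (lshift m a) = 0.
Proof.
move=> ip jp; rewrite pderiv_lshift // /pderiv.
case: (ip) (jp) => [ip1 ip2] [jp1 jp2].
rewrite (near_eq_derive
  (g := fun=> block_mx (1%:M : 'M[R]_1) 0 0 (jac i.2 j.2 p.2))).
  exact: derive_cst.
apply: filterS (near_chart_map2 manB ip1 jp1) => u [iu ju _] /=.
by rewrite cylinder_jac.
Qed.

Lemma pderiv_cylinder_jac_r i j p (b : 'I_m) : dom i p -> dom j p ->
  pderiv (fun k => jac k j) i p (rshift 1 b) =
  block_mx (0 : 'M[R]_1) 0 0 (pderiv (fun k => jac k j.2) i.2 p.2 b).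
Proof.
move=> ip jp; rewrite pderiv_rshift // /pderiv.
case: (ip) (jp) => [ip1 ip2] [jp1 jp2].
rewrite (near_eq_derive (g := fun u => block_mx (1%:M : 'M[R]_1) 0 0
  (jac i.2 j.2 (chart_inv i.2 u)))).
  by rewrite derive_block_dr //; exact: jac_derivable.
apply: filterS (near_chart_map2 manN ip2 jp2) => u [iu ju _] /=.
by rewrite cylinder_jac.
Qed.

Lemma cylinder_gamma_connection : is_connection cylinder_gamma.
Proof.
split=> [a|i j p a ip jp]; first exact: cylinder_gamma_smooth.
have [[_ chG] _ _] := LC.
have [_ ip2] := ip; have [_ jp2] := jp.
rewrite big_split_ord /= big_ord1.
case: (split_ordP a) => b ->.
  (* Along t the law reduces to the commutation of J with the Jacobian of N. *)
  rewrite pderiv_cylinder_jac_l // !cylinder_gamma_l cylinder_jac //.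
  rewrite big1 ?addr0 => [|l _]; last by rewrite block_mxEur mxE scale0r.
  rewrite block_mxEul !ord1 mxE scale1r add0r !mulmx_block.
  rewrite !(mulmx0, mul0mx, addr0, add0r) mulmxN mulNmx.
  by rewrite (endoJ.2 _ _ _ ip2 jp2).
(* Along N the lower right block is the law of Gamma, the upper right one that of J, and the lower
   left one that of the form h_t(J ., .). *)
rewrite pderiv_cylinder_jac_r // !cylinder_gamma_r cylinder_jac //.
rewrite block_mxEdl mxE scale0r.
rewrite add0r; set jn := jac i.2 j.2 p.2.
under eq_bigr do rewrite cylinder_gamma_r block_mxEdr mulmx_block
  !(mulmx0, mul0mx, addr0, add0r, mul1mx) scale_block_mx scaler0.
rewrite sum_block_mx add_block_mx mulmx_block.
rewrite !(mulmx0, mul0mx, mulmx1, addr0, add0r) -chG // mulNmx -row_mul.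
rewrite big1_eq (endoJ.2 _ _ _ ip2 jp2) (fiber_twin_change ip jp) -/jn.
congr block_mx.
  rewrite row_mul mulmx_sum_row -sumrN; apply: eq_bigr => l _.
  by rewrite scalerN mxE.
apply/colP => c; rewrite mxE summxE [LHS]mxE; apply: eq_bigr => l _.
by rewrite colE mulmxA -colE ![in RHS]mxE mulrC; congr (_ * _); rewrite !mxE.
Qed.

(* d/dt (cos 2t h - sin 2t h~) = - 2 (cos 2t h~ + sin 2t h) *)
Lemma pderiv_cylinder_metric_l i p (a : 'I_1) : dom i p ->
  pderiv cylinder_metric i p (lshift m a) =
  block_mx (0 : 'M[R]_1) 0 0 (- (fiber_twin i p + fiber_twin i p)).
Proof.
move=> ip; rewrite pderiv_lshift // /pderiv; have [ip1 ip2] := ip.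
set H := h i.2 p.2; set K := J i.2 p.2 *m H; set x := chart_map i.1 p.1.
have lin (c s d e : R) : 2 * - s * d - 2 * c * e =
    - (c * e - s * - d + (c * e - s * - d)) by ring.
have dcos t : differentiable (@cos R) t.
  exact/derivable1_diffP/derivable_cos.
have dsin t : differentiable (@sin R) t.
  exact/derivable1_diffP/derivable_sin.
have d2 (f : R -> R) : (forall t, differentiable f t) ->
    differentiable (fun v : 'rV[R]_1 => f (2 * v 0 0)) x.
  move=> df; apply: (@differentiable_comp _ _ _ _ (@double_angle R) f) => //.
  exact/linear_differentiable/double_angle_continuous.
have dcH : differentiable (fun v : 'rV[R]_1 => cos (2 * v 0 0) *: H) x.
  exact/differentiableZl/d2.
have dsK : differentiable (fun v : 'rV[R]_1 => sin (2 * v 0 0) *: K) x.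
  exact/differentiableZl/d2.
rewrite (near_eq_derive (g := fun v : 'rV[R]_1 => block_mx (1%:M : 'M[R]_1) 0 0
  (cos (2 * v 0 0) *: H - sin (2 * v 0 0) *: K))); last first.
  apply: filterS (near_chart_map2 manB ip1 ip1) => u [_ _ uK] /=.
  by rewrite /cylinder_metric /fiber_metric /= uK.
rewrite derive_block_dr; last exact/diff_derivable/differentiableB.
rewrite deriveB; try exact: diff_derivable.
rewrite !derive_scalel; try exact: d2.
rewrite ord1 !derive_double_angle // !derive_val.
congr block_mx; rewrite /fiber_twin /fiber_metric -/H -/K -/x.
rewrite mulmxBr -!scalemxAr -/K mulmxA JJ // mulNmx mul1mx.
clearbody K H; apply/matrixP => c d; rewrite !mxE; exact: lin.
Qed.

Lemma pderiv_cylinder_metric_r i p (b : 'I_m) : dom i p ->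
  pderiv cylinder_metric i p (rshift 1 b) =
  block_mx (0 : 'M[R]_1) 0 0 (Gamma b i.2 p.2 *m fiber_metric i p +
                              fiber_metric i p *m (Gamma b i.2 p.2)^T).
Proof.
move=> ip; rewrite pderiv_rshift // /pderiv; have [ip1 ip2] := ip.
have [_ _ /(_ i.2 p.2 b ip2) compat] := LC.
have dh := smooth_components_derivable (v := delta_mx 0 b) bilh.1 ip2.
have dJ := smooth_components_derivable (v := delta_mx 0 b) endoJ.1 ip2.
have [_ _ _ /(_ i.2)[_ _ cK _ _] _] := manN.
pose c := cos (2 * chart_map i.1 p.1 0 0).
pose s := sin (2 * chart_map i.1 p.1 0 0).
pose x := chart_map i.2 p.2.
have [dF DF] := derive_pencil c s dJ dh dh.
rewrite -[LHS]/('D_(delta_mx 0 b) (fun u => block_mx (1%:M : 'M[R]_1) 0 0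
  (c *: (h i.2 \o chart_inv i.2) u -
   s *: ((J i.2 \o chart_inv i.2) u *m (h i.2 \o chart_inv i.2) u))) x).
rewrite (derive_block_dr _ _ _ dF) DF -/(pderiv h i.2 p.2 b).
rewrite -/(pderiv J i.2 p.2 b) compat parJ // [in LHS]/= cK ?inE //.
congr block_mx.
rewrite /fiber_metric -/c -/s; move: (h _ _) (J _ _) (Gamma _ _ _) => H A G.
(* The product rule for J h reads (G A - A G) H + A (G H + H G^T), where the two A G H terms cancel:
   this is how parallelism of J makes D compatible with h_t. *)
rewrite !mulmxBl mulmxBr mulmxDr -!scalemxAl -!scalemxAr !mulmxA.
by rewrite addrA subrK !scalerDr opprD addrACA.
Qed.

(** Along d_t, self-adjointness of J makes both terms equal to - h_t(J ., .). Along N, the mixed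
    blocks cancel because g(nabla_X d_t, Y) = - h_t(J X, Y) is opposite to g(d_t, nabla_X Y). *)
Lemma cylinder_gamma_compatible : metric_compatible cylinder_metric cylinder_gamma.
Proof.
move=> i p a ip; case: (split_ordP a) => b ->.
  rewrite pderiv_cylinder_metric_l // cylinder_gamma_l /cylinder_metric tr_block_mx.
  rewrite !mulmx_block !trmx0 !(mulmx0, mul0mx, addr0, add0r).
  rewrite linearN /= mulNmx mulmxN J_fiber_metric // -/(fiber_twin i p).
  by rewrite add_block_mx !addr0 opprD.
rewrite pderiv_cylinder_metric_r // cylinder_gamma_r /cylinder_metric tr_block_mx.
rewrite !mulmx_block !trmx0 !(mulmx0, mul0mx, mul1mx, mulmx1, addr0, add0r).
rewrite add_block_mx add0r tr_col fiber_twin_sym // linearN /= tr_row.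
rewrite mulNmx -row_mul -/(fiber_twin i p) addNr mulmxN [col b _^T]colE mulmxA.
by rewrite J_fiber_metric // -colE subrr.
Qed.

Lemma cylinder_gamma_torsion_free : torsion_free cylinder_gamma.
Proof.
have [_ tf _] := LC.
(* Both sides are - J d_b, the common value of nabla_t d_b and nabla_b d_t. *)
have mixed i p (a : 'I_1) (b : 'I_m) :
    row (rshift 1 b) (cylinder_gamma (lshift m a) i p) =
    row (lshift m a) (cylinder_gamma (rshift 1 b) i p).
  rewrite cylinder_gamma_l cylinder_gamma_r; apply/rowP => c.
  rewrite [LHS]mxE [RHS]mxE; case: (split_ordP c) => d ->.
    by rewrite block_mxEdl block_mxEul !mxE.
  by rewrite block_mxEdr block_mxEur !mxE.
move=> i p a b ip; case: (split_ordP a) => a' ->; case: (split_ordP b) => b' ->.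
- by rewrite !ord1.
- exact: mixed.
- exact/esym/mixed.
(* Two directions of N: the d_t component is symmetric since h_t(J ., .) is, the other by
   torsion-freeness of Gamma. *)
rewrite !cylinder_gamma_r; apply/rowP => c.
rewrite [LHS]mxE [RHS]mxE; case: (split_ordP c) => d ->.
  by rewrite !block_mxEdl [LHS]mxE [RHS]mxE -[in LHS](fiber_twin_sym ip) mxE.
rewrite !block_mxEdr; have := tf i.2 p.2 a' b' ip.2.
by move=> /rowP/(_ d); rewrite !mxE.
Qed.

Lemma cylinder_gamma_levi_civita : is_levi_civita cylinder_metric cylinder_gamma.
Proof.
by split; [exact: cylinder_gamma_connection|exact: cylinder_gamma_torsion_free|
  exact: cylinder_gamma_compatible].
Qed.

(** * Covariant derivative of phi and the Sasaki-like identities *)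

Lemma pderiv_cylinder_phi_l i p (a : 'I_1) : dom i p ->
  pderiv cylinder_phi i p (lshift m a) = 0.
Proof.
move=> ip; rewrite pderiv_lshift // /pderiv.
rewrite -[LHS]/('D_(delta_mx 0 a) (cst (cylinder_phi i p)) (chart_map i.1 p.1)).
by rewrite derive_cst.
Qed.

Lemma pderiv_cylinder_phi_r i p (b : 'I_m) : dom i p ->
  pderiv cylinder_phi i p (rshift 1 b) =
  block_mx (0 : 'M[R]_1) 0 0 (pderiv J i.2 p.2 b).
Proof.
move=> ip; rewrite pderiv_rshift // /pderiv.
have dJ := smooth_components_derivable (v := delta_mx 0 b) endoJ.1 ip.2.
exact: (derive_block_dr _ _ _ dJ).
Qed.

(** The component x disappears because phi commutes with the matrix of nabla_t. In the N directions
    parallelism of J kills the lower right block, while J^2 = -1 turns the mixed blocks of the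
    connection into - X and - h_t X^T. *)
Lemma nabla_cylinder_phi i p (x : 'rV[R]_1) (X : 'rV[R]_m) : dom i p ->
  nabla_endo cylinder_gamma cylinder_phi i p (row_mx x X) =
  block_mx (0 : 'M[R]_1) (- X) (- (fiber_metric i p *m X^T)) 0.
Proof.
move=> ip; have ip2 := ip.2; rewrite /nabla_endo big_split_ord /= big_ord1.
rewrite pderiv_cylinder_phi_l // cylinder_gamma_l /cylinder_phi !mulmx_block.
rewrite !(mulmx0, mul0mx, addr0, add0r) mulmxN mulNmx subrr scaler0 add0r.
under eq_bigr do rewrite pderiv_cylinder_phi_r // cylinder_gamma_r !mulmx_block
  !(mulmx0, mul0mx, addr0, add0r) row_mxEr add_block_mx opp_block_mx
  add_block_mx !(addr0, add0r, oppr0) scale_block_mx mulNmx opprK -row_mul JJ //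
  parJ // subrK subrr !scaler0.
rewrite sum_block_mx !big1_eq; congr block_mx.
  rewrite -[X in RHS]mulmx1 mulmx_sum_row -sumrN; apply: eq_bigr => l _.
  by rewrite linearN scalerN.
apply/colP => c; rewrite summxE [RHS]mxE [X in - X]mxE -sumrN.
apply: eq_bigr => l _; rewrite mxE colE mulmxA -colE J_fiber_twin //.
by move: (fiber_metric i p) => K; rewrite !mxE mulrN mulrC.
Qed.

Local Notation xi := (row_mx (1%:M : 'M[R]_1) (0 : 'rV[R]_m)).
Local Notation eta := (col_mx (1%:M : 'M[R]_1) (0 : 'cV[R]_m)).

Lemma cylinder_contact i p : dom i p ->
  [/\ xi *m cylinder_phi i p = 0,
      cylinder_phi i p *m cylinder_phi i p = - 1%:M + eta *m xi,
      cylinder_phi i p *m eta = 0,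
      xi *m eta = 1%:M &
      forall X Y : 'rV[R]_(1 + m),
        bil cylinder_metric i p (X *m cylinder_phi i p) (Y *m cylinder_phi i p) =
        - bil cylinder_metric i p X Y + (X *m eta) 0 0 * (Y *m eta) 0 0].
Proof.
move=> ip; have ip2 := ip.2; split.
- by rewrite mul_row_block !(mulmx0, mul0mx, addr0) row_mx0.
- rewrite mulmx_block mul_col_row (scalar_mx_block 1 m 1) opp_block_mx.
  rewrite add_block_mx !(mulmx0, mul0mx, mulmx1, addr0, add0r, oppr0) JJ //.
  by rewrite addNr.
- by rewrite mul_block_col !(mulmx0, mul0mx, addr0) col_mx0.
- by rewrite mul_row_col mulmx1 mulmx0 addr0.
move=> X Y; rewrite /bil.
(* Stripped of X and Y, this is phi g phi^T = - g + eta eta^T, whose lower right block is J h_t J^T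
   = - h_t. *)
have -> : X *m cylinder_phi i p *m cylinder_metric i p *m (Y *m cylinder_phi i p)^T =
    - (X *m cylinder_metric i p *m Y^T) + (X *m eta) *m (Y *m eta)^T.
  rewrite !trmx_mul !mulmxA -mulNmx -mulmxN -mulmxDl; congr (_ *m _).
  rewrite -!mulmxA -mulmxDr; congr (_ *m _).
  rewrite /cylinder_phi /cylinder_metric tr_block_mx tr_col_mx mul_col_row !mulmx_block.
  rewrite opp_block_mx add_block_mx !trmx0 trmx1.
  rewrite !(mulmx0, mul0mx, mulmx1, addr0, add0r, oppr0) addNr.
  by rewrite J_fiber_metric // J_fiber_twin.
move: (_ *m Y^T) (X *m eta) (Y *m eta) => A P Q.
by rewrite !mxE big_ord1 mxE.
Qed.

Lemma cylinder_sasaki_conditions i p : dom i p ->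
  let F x y z :=
    bil cylinder_metric i p (y *m nabla_endo cylinder_gamma cylinder_phi i p x) z in
  forall X Y Z : 'rV[R]_(1 + m),
    X *m eta = 0 -> Y *m eta = 0 -> Z *m eta = 0 ->
    [/\ F X Y Z = 0, F xi Y Z = 0, F xi xi Z = 0 &
        F X Y xi = - bil cylinder_metric i p X Y].
Proof.
move=> ip F X Y Z.
rewrite -(hsubmxK X) -(hsubmxK Y) -(hsubmxK Z) !mul_row_col !mulmx1 !mulmx0.
(* Vectors of H are the rows whose left block is zero, so only the N components survive. *)
rewrite !addr0; move: (rsubmx X) (rsubmx Y) (rsubmx Z) => X' Y' Z' -> -> ->.
rewrite /F /bil /cylinder_metric !nabla_cylinder_phi // oppr0 trmx0 mulmx0 oppr0.
rewrite block_mx0 !mulmx0 !mul0mx !mul_row_block !tr_row_mx !mul_row_col.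
rewrite !(trmx0, trmx1, mulmx0, mul0mx, mulmx1, addr0, add0r).
split; try by rewrite mxE.
(* The derivative of phi produces Y h_t X^T; a 1 x 1 matrix equals its transpose, and h_t is
   symmetric. *)
have -> : X' *m fiber_metric i p *m Y'^T = (Y' *m (fiber_metric i p *m X'^T))^T.
  by rewrite !trmx_mul trmxK fiber_metric_sym.
by rewrite mulmxN !mxE.
Qed.

End CylinderGeometry.

(** * From the coordinate-free hypotheses on N to the two cylinders *)

Lemma parallel_endomorphism (R : realType) m (N : charted_space R m)
    (J : components N 'M[R]_m) (Gamma : 'I_m -> components N 'M[R]_m) i p a :
  (forall X, nabla_endo Gamma J i p X = 0) ->
  pderiv J i p a = Gamma a i p *m J i p - J i p *m Gamma a i p.
Proof.
move=> /(_ (delta_mx 0 a)); rewrite /nabla_endo (bigD1 a) //= big1; last first.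
  by move=> b ba; rewrite mxE (negPf ba) andbF scale0r.
rewrite mxE !eqxx scale1r addr0 -addrA => /eqP.
by rewrite addr_eq0 opprB => /eqP.
Qed.

Lemma cylinder_sasaki_like (R : realType) (n : nat) (B : charted_space R 1)
    (N : charted_space R (2 * n)) (J h : components N 'M[R]_(2 * n)) :
  is_manifold B -> angular_coordinate B ->
  holomorphic_complex_riemannian J h ->
  sasaki_like (cyl_phi B J) (cyl_xi B N) (cyl_eta B N) (cyl_metric B J h).
Proof.
move=> manB angB [manN [endoJ JJ] [bilh sigh] hJJ [Gamma LC parJ0]].
have hsym i p : dom i p -> (h i p)^T = h i p.
  by move=> ip; have [] := sigh i p ip.
have hJ i p : dom i p -> J i p *m h i p *m (J i p)^T = - h i p.
  move=> ip; apply: bilinear_form_inj => X Y.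
  have := hJJ i p X Y ip; rewrite /bil trmx_mul !mulmxA => ->.
  by rewrite mulmxN mulNmx [RHS]mxE.
have parJ i p a : dom i p ->
    pderiv J i p a = Gamma a i p *m J i p - J i p *m Gamma a i p.
  by move=> ip; apply: parallel_endomorphism => X; exact: parJ0.
have manM := product_is_manifold manB manN.
split; first split; first split.
(* The dimensions (2 * n).+1 and 1 + 2 * n are convertible, so the results in block form apply as
   they stand. *)
- exact: manM.
- exact: (cylinder_phi_endomorphism manB angB manN endoJ).
- exact: (cylinder_xi_vector_field manB angB manN).
- exact: (cylinder_eta_one_form manB angB manN).
- split; first exact: (cylinder_metric_bilinear manB angB manN endoJ bilh).
  move=> i p ip; apply: (cylinder_metric_signature JJ hJ ip).
  exact: sigh ip.2.
- move=> i p ip; exact: (cylinder_contact JJ hJ ip).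
exists (cylinder_gamma J h Gamma).
  exact: (cylinder_gamma_levi_civita manB angB manN endoJ JJ bilh hsym hJ LC parJ).
move=> i p ip; exact: (cylinder_sasaki_conditions manB manN endoJ JJ hsym hJ parJ ip).
Qed.

Theorem theorem3p5 (R : realType) (n : nat) (N : charted_space R (2 * n))
    (J h : components N 'M[R]_(2 * n))
    (hN : holomorphic_complex_riemannian J h) :
  sasaki_like (cyl_phi (positive_line R) J) (cyl_xi (positive_line R) N)
    (cyl_eta (positive_line R) N) (cyl_metric (positive_line R) J h) /\
  (compact [set: N] ->
     compact [set: cylinder (circle R) N] /\
     sasaki_like (cyl_phi (circle R) J) (cyl_xi (circle R) N)
       (cyl_eta (circle R) N) (cyl_metric (circle R) J h)).
Proof.
split.
  apply: cylinder_sasaki_like hN; first exact: positive_line_manifold.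
  exact: positive_line_angular.
move=> cN; split.
  by have := compact_setX (@circle_compact R) cN; rewrite setXTT.
apply: cylinder_sasaki_like hN; first exact: circle_manifold.
exact: circle_angular.
Qed.
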